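(* Let $k$ be a field of prime characteristic $p$ and let $G$ be a net-free generalized caterpillar graph on the vertex set $[n]=\{1,\dots,n\}$, with binomial edge ideal $J_G\subseteq S=k[x_1,\dots,x_n,y_1,\dots,y_n]$. Then $J_G$ is symbolic $F$-split.
   Context: All graphs are finite and simple. Clique join via an edge: for a graph $H$, an edge $e=\{w_1,w_2\}\in E(H)$ and $t\ge 3$, the clique join of $K_t$ on $H$ via $e$ is obtained from $H$ by adding $t-2$ new vertices $u_1,\dots,u_{t-2}$, all edges $\{u_i,w_j\}$ for $1\le i\le t-2$, $j=1,2$, and all edges $\{u_i,u_j\}$, $i<j$. Adding a whisker to $H$ at a vertex $v$ means adding one new vertex $u$ and the edge $\{u,v\}$. Generalized caterpillar graph: a graph obtained from a path $P$ by performing in succession clique joins of some complete graphs $K_{t_1},\dots,K_{t_m}$ via pairwise distinct edges $e_1,\dots,e_m$ of $P$ and finally, possibly, adding a finite number of whiskers to the vertices (of the graph obtained after the clique joins). Net: the graph on six vertices consisting of a triangle with exactly one whisker attached at each of its three vertices. A graph is net-free if it has no induced subgraph isomorphic to the net. Binomial edge ideal: for a graph $G$ on $[n]$, $J_G$ is the ideal of $S$ generated by the binomials $f_{i,j}=x_iy_j-y_ix_j$ with $\{i,j\}\in E(G)$. Symbolic power: if $I$ is an ideal of a Noetherian ring with minimal primes $\mathfrak p_1,\dots,\mathfrak p_r$, then $I^{(m)}=\mathfrak q_1\cap\dots\cap\mathfrak q_r$, where $\mathfrak q_i$ is the $\mathfrak p_i$-primary component of $I^m$; $I^{(0)}$ is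 the whole ring. Symbolic $F$-split: let $R$ be a reduced Noetherian ring of prime characteristic $p$ and let $R^{1/p}$ be the ring obtained by adjoining all $p$-th roots of elements of $R$. A sequence $\{I_n\}_{n\ge0}$ of ideals of $R$ is an $F$-split filtration if: (1) $I_0=R$; (2) $I_{n+1}\subseteq I_n$ for all $n\ge 0$; (3) $I_nI_m\subseteq I_{n+m}$ for all $n,m\ge0$; (4) there is a splitting $\phi:R^{1/p}\to R$ of the inclusion $R\subseteq R^{1/p}$ ($\phi$ is $R$-linear with $\phi|_R=\mathrm{id}_R$) such that $\phi((I_{np+1})^{1/p})\subseteq I_{n+1}$ for every $n\ge0$. An ideal $I\subseteq R$ is symbolic $F$-split if $\{I^{(n)}\}_{n\ge0}$ is an $F$-split filtration. *)

(* Defs.v *)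
From HB Require Import structures.
From mathcomp Require Import all_boot all_order all_algebra.
From mathcomp Require Import classical_sets.
From mathcomp Require Import mpoly.

Set Implicit Arguments.
Unset Strict Implicit.
Unset Printing Implicit Defensive.

Import GRing.Theory.
Local Open Scope ring_scope.

Record sgraph (V : finType) := SGraph {
  adj :> rel V;
  adj_sym : ssrbool.symmetric adj;
  adj_irr : irreflexive adj }.

Definition isomorphic (V W : finType) (G : sgraph V) (H : sgraph W) : Prop :=
  exists2 f : V -> W, bijective f & forall u v, G u v = H (f u) (f v).

Definition has_induced (V W : finType) (G : sgraph V) (H : sgraph W) : Prop :=
  exists2 f : W -> V, injective f & forall u v, H u v = G (f u) (f v).

Section Constructions.
Variables (V : finType) (H : sgraph V).

Definition clique_join_rel (w1 w2 : V) (t : nat) : rel (V + 'I_(t - 2)) :=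
  fun a b => match a, b with
  | inl u, inl v => H u v
  | inl v, inr _ | inr _, inl v => (v == w1) || (v == w2)
  | inr i, inr j => i != j
  end.

Lemma clique_join_sym w1 w2 t : ssrbool.symmetric (@clique_join_rel w1 w2 t).
Proof. by case=> [u|i] [v|j] //=; [exact: adj_sym | rewrite eq_sym]. Qed.

Lemma clique_join_irr w1 w2 t : irreflexive (@clique_join_rel w1 w2 t).
Proof. by case=> [u|i] /=; [exact: adj_irr | rewrite eqxx]. Qed.

Definition clique_join w1 w2 t : sgraph (V + 'I_(t - 2))%type :=
  SGraph (@clique_join_sym w1 w2 t) (@clique_join_irr w1 w2 t).

(* [q] whiskers added to [H], the [i]-th one at the vertex [w i] *)
Definition whiskers_rel (q : nat) (w : 'I_q -> V) : rel (V + 'I_q) :=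
  fun a b => match a, b with
  | inl u, inl v => H u v
  | inl v, inr i | inr i, inl v => v == w i
  | inr _, inr _ => false
  end.

Lemma whiskers_sym q w : ssrbool.symmetric (@whiskers_rel q w).
Proof. by case=> [u|i] [v|j] //=; exact: adj_sym. Qed.

Lemma whiskers_irr q w : irreflexive (@whiskers_rel q w).
Proof. by case=> [u|i] //=; exact: adj_irr. Qed.

Definition whiskers q (w : 'I_q -> V) : sgraph (V + 'I_q)%type :=
  SGraph (@whiskers_sym q w) (@whiskers_irr q w).

End Constructions.

Section Examples.
Variable l : nat.

Definition path_rel : rel 'I_l :=
  fun i j => (i.+1 == j :> nat) || (j.+1 == i :> nat).

Lemma path_rel_sym : ssrbool.symmetric path_rel.
Proof. by move=> i j; rewrite /path_rel orbC. Qed.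

Lemma path_rel_irr : irreflexive path_rel.
Proof. by move=> i; rewrite /path_rel orbb eqn_leq ltnn. Qed.

Definition path_graph : sgraph 'I_l := SGraph path_rel_sym path_rel_irr.

Definition complete_rel : rel 'I_l := fun i j => i != j.

Lemma complete_rel_sym : ssrbool.symmetric complete_rel.
Proof. by move=> i j; rewrite /complete_rel eq_sym. Qed.

Lemma complete_rel_irr : irreflexive complete_rel.
Proof. by move=> i; rewrite /complete_rel eqxx. Qed.

Definition complete_graph : sgraph 'I_l :=
  SGraph complete_rel_sym complete_rel_irr.

End Examples.

(* [clique_joins P H f E]: [H] is obtained from [P] by performing in succession
   clique joins via the pairwise distinct edges of [P] collected in [E];
   [f] is the resulting inclusion of the vertices of [P] in those of [H]. *)
Inductive clique_joins (V : finType) (P : sgraph V) :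
    forall W : finType, sgraph W -> (V -> W) -> {set {set V}} -> Prop :=
| clique_joins0 : clique_joins P P id finset.set0
| clique_joinsS (W : finType) (H : sgraph W) (f : V -> W) (E : {set {set V}})
    (w1 w2 : V) (t : nat) :
    clique_joins P H f E -> P w1 w2 -> [set w1; w2]%SET \notin E -> (3 <= t)%N ->
    clique_joins P (clique_join H (f w1) (f w2) t) (fun v => inl (f v))
      ([set w1; w2] |: E)%SET.

Definition generalized_caterpillar (V : finType) (G : sgraph V) : Prop :=
  exists (l : nat) (W : finType) (H : sgraph W) (f : 'I_l.+1 -> W)
    (E : {set {set 'I_l.+1}}) (q : nat) (w : 'I_q -> W),
    clique_joins (path_graph l.+1) H f E /\ isomorphic G (whiskers H w).

Definition net : sgraph ('I_3 + 'I_3)%type := whiskers (complete_graph 3) id.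

Definition net_free (V : finType) (G : sgraph V) : Prop := ~ has_induced G net.

Section Ideals.
Local Open Scope classical_set_scope.
Variable R : comNzRingType.
Implicit Types (A I J P Q X : set R).

Definition is_ideal I : Prop :=
  [/\ I 0, forall x y, I x -> I y -> I (x + y) & forall a x, I x -> I (a * x)].

Definition ideal_gen X : set R :=
  [set f | exists (r : nat) (a x : 'I_r -> R),
     (forall i, X (x i)) /\ f = \sum_(i < r) a i * x i].

Definition ideal_mul I J : set R :=
  ideal_gen [set f | exists a b, [/\ I a, J b & f = a * b]].

Definition ideal_exp I (m : nat) : set R := iter m (ideal_mul I) setT.

Definition radical I : set R := [set f | exists m : nat, I (f ^+ m)].

Definition prime_ideal P : Prop :=
  [/\ is_ideal P, ~ P 1 & forall a b, P (a * b) -> P a \/ P b].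

Definition primary_ideal Q : Prop :=
  [/\ is_ideal Q, ~ Q 1 & forall a b, Q (a * b) -> Q a \/ radical Q b].

Definition minimal_prime I P : Prop :=
  [/\ prime_ideal P, I `<=` P &
      forall P', prime_ideal P' -> I `<=` P' -> P' `<=` P -> P' = P].

Definition irredundant_primary_decomposition A (r : nat) (q : 'I_r -> set R) :
    Prop :=
  [/\ forall i, primary_ideal (q i),
      A = \bigcap_i q i,
      forall i j, radical (q i) = radical (q j) -> i = j &
      forall i, ~ (\bigcap_(j in [set j | j != i]) q j `<=` q i)].

Definition primary_component A P Q : Prop :=
  exists (r : nat) (q : 'I_r -> set R),
    irredundant_primary_decomposition A q /\
    exists i, q i = Q /\ radical Q = P.

(* Meant for Noetherian rings, where the [P]-primary component of [I ^ m] exists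
   and is unique for each of the finitely many minimal primes [P] of [I]. *)
Definition symbolic_power I (m : nat) : set R :=
  if m is 0 then setT
  else [set f | forall P Q,
          minimal_prime I P -> primary_component (ideal_exp I m) P Q -> Q f].

End Ideals.

(* The ring of [p]-th roots. Since [R] is reduced, every element of R^{1/p} is
   [pth_root x] for a unique [x] in [R], and [pth_root] is a ring isomorphism;
   so R^{1/p} is encoded as a copy of the ring [R], in which the element [a] of
   [R] becomes [a%:A = pth_root (a ^+ p)] (see [pth_rootXp]). *)
Definition pth_roots (R : comNzRingType) (p : nat) of p \in [pchar R] :
  predArgType := R.

Section PthRoots.
Variables (R : comNzRingType) (p : nat) (pcharR : p \in [pchar R]).
Local Notation R1p := (pth_roots pcharR).

HB.instance Definition _ := GRing.ComNzRing.on R1p.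

Definition pth_root (x : R) : R1p := x.

Lemma pth_root_additive : zmod_morphism pth_root. Proof. by []. Qed.
HB.instance Definition _ :=
  GRing.isZmodMorphism.Build R R1p pth_root pth_root_additive.

Lemma pth_root_multiplicative : monoid_morphism pth_root. Proof. by []. Qed.
HB.instance Definition _ :=
  GRing.isMonoidMorphism.Build R R1p pth_root pth_root_multiplicative.

Definition pth_roots_scale (a : R) (x : R1p) : R1p := pth_root (a ^+ p) * x.

Fact pth_roots_scaleA a b x :
  pth_roots_scale a (pth_roots_scale b x) = pth_roots_scale (a * b) x.
Proof. by rewrite /pth_roots_scale mulrA -rmorphM -exprMn. Qed.

Fact pth_roots_scale1 : left_id 1 pth_roots_scale.
Proof. by move=> x; rewrite /pth_roots_scale expr1n rmorph1 mul1r. Qed.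

Fact pth_roots_scaleDr : right_distributive pth_roots_scale +%R.
Proof. by move=> a x y; rewrite /pth_roots_scale mulrDr. Qed.

Fact pth_roots_scaleDl x : {morph pth_roots_scale^~ x : a b / a + b}.
Proof.
move=> a b; rewrite /pth_roots_scale -!(pFrobenius_autE pcharR).
by rewrite pFrobenius_autD_comm ?rmorphD ?mulrDl //; exact: mulrC.
Qed.

HB.instance Definition _ := GRing.Zmodule_isLmodule.Build R R1p
  pth_roots_scaleA pth_roots_scale1 pth_roots_scaleDr pth_roots_scaleDl.

Fact pth_roots_scaleAl (a : R) (x y : R1p) : a *: (x * y) = (a *: x) * y.
Proof. exact: mulrA. Qed.

HB.instance Definition _ :=
  GRing.Lmodule_isLalgebra.Build R R1p pth_roots_scaleAl.

Lemma pth_root_bij : bijective pth_root. Proof. by exists id. Qed.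

Lemma pth_rootXp (x : R) : pth_root x ^+ p = x%:A.
Proof.
by rewrite -[LHS]rmorphXn -[RHS]/(pth_root (x ^+ p) * 1) mulr1.
Qed.

Lemma pth_roots_inclusion_inj :
  (forall (x : R) (m : nat), x ^+ m = 0 -> x = 0) ->
  injective (fun a : R => a%:A : R1p).
Proof.
move=> redR a b /(congr1 (fun x : R1p => x - b%:A)).
rewrite subrr -scalerBl -pth_rootXp => /redR /eqP.
by rewrite subr_eq0 => /eqP.
Qed.

Definition pth_root_ideal (I : set R) : set R1p :=
  [set x : R1p | exists2 a : R, I a & x ^+ p = a%:A]%classic.

Definition F_split_filtration (I : nat -> set R) : Prop :=
  [/\ forall n, is_ideal (I n),
      I 0%N = setT%classic,
      forall n, (I n.+1 `<=` I n)%classic,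
      forall n m, (ideal_mul (I n) (I m) `<=` I (n + m)%N)%classic &
      exists phi : {linear R1p -> R^o},
        (forall a : R, phi a%:A = a) /\
        forall n x, pth_root_ideal (I (n * p + 1)%N) x -> I n.+1 (phi x)].

Definition symbolic_F_split (I : set R) : Prop :=
  F_split_filtration (symbolic_power I).

End PthRoots.

Section BinomialEdgeIdeal.
Variables (k : fieldType) (n : nat).

Definition xvar (i : 'I_n) : {mpoly k[n + n]} := 'X_(lshift n i).
Definition yvar (i : 'I_n) : {mpoly k[n + n]} := 'X_(rshift n i).

Definition binomial_edge_ideal (G : sgraph 'I_n) : set {mpoly k[n + n]} :=
  ideal_gen [set f | exists2 e : 'I_n * 'I_n, G e.1 e.2 &
    f = xvar e.1 * yvar e.2 - yvar e.1 * xvar e.2]%classic.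

Lemma pchar_mpoly (p : nat) :
  p \in [pchar k] -> p \in [pchar {mpoly k[n + n]}].
Proof. by rewrite pchar_lalg. Qed.

End BinomialEdgeIdeal.

Arguments binomial_edge_ideal k {n} G.

(* Main.v *)
From HB Require Import structures.
Require Import Defs.
From mathcomp Require Import all_boot all_order all_algebra perm mpoly.
From mathcomp Require Import zify ring.
From mathcomp Require Import boolp classical_sets.

(** Order the vertices as v_1, ..., v_n along the path, each path vertex being
    followed by its whiskers and then by the vertices joined via the next edge;
    one whisker of the first path vertex comes first.  Being net-free is what
    allows all whiskers to be carried by path vertices.  In this order every
    vertex lying strictly between the ends of an edge is simplicial and adjacent
    to one of them, left neighbourhoods are cliques, and v_1 is simplicial.

    Let g = y_1 f_{12} f_{23} ... f_{n-1,n} x_n (indices along the order).  The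
    monomial with all exponents p-1 has coefficient 1 in g^(p-1), so composing
    multiplication by g^(p-1) with a p^-1-linear Cartier map gives a splitting.
    At a minimal prime P of J_G the factors of g that lie in P generate J_G S_P;
    the pigeonhole principle on exponents then gives
    g^(p-1) J_G^(mp+1) S_P <= (J_G^(m+1))^[p] S_P, and applying the Cartier map
    gives the required containment.

    Minimal primes are never computed.  If a ring map S -> S[eps] lifting the
    identity sends J_G into P[eps], it sends P into P[eps]; moving the generic
    point of P by suitable such deformations shows that the variables in P belong
    to cut vertices and that minors in P come from connected vertices. *)

Set Implicit Arguments.
Unset Strict Implicit.
Unset Printing Implicit Defensive.

Import Order.TTheory GRing.Theory.
Local Open Scope ring_scope.
Local Open Scope classical_set_scope.

(** * Primary decomposition in Noetherian rings *)

Section IdealTheory.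
Variable R : comNzRingType.
Implicit Types (A B I J P Q X Y : set R).

Lemma is_ideal0 I : is_ideal I -> I 0. Proof. by case. Qed.
Lemma is_idealD I x y : is_ideal I -> I x -> I y -> I (x + y).
Proof. by case=> _ h _; exact: h. Qed.
Lemma is_idealMl I a x : is_ideal I -> I x -> I (a * x).
Proof. by case=> _ _; apply. Qed.
Lemma is_idealMr I a x : is_ideal I -> I x -> I (x * a).
Proof. by rewrite mulrC; exact: is_idealMl. Qed.
Lemma is_idealN I x : is_ideal I -> I x -> I (- x).
Proof. by rewrite -mulN1r; exact: is_idealMl. Qed.
Lemma is_idealB I x y : is_ideal I -> I x -> I y -> I (x - y).
Proof. by move=> hI Ix Iy; apply: is_idealD => //; exact: is_idealN. Qed.
Lemma is_ideal_sum I (T : Type) (r : seq T) (C : pred T) (F : T -> R) :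
  is_ideal I -> (forall i, C i -> I (F i)) -> I (\sum_(i <- r | C i) F i).
Proof.
move=> hI IF; apply: (big_ind I); [exact: is_ideal0 | | exact: IF].
by move=> x y; exact: is_idealD.
Qed.

Lemma ideal_genS X : X `<=` ideal_gen X.
Proof.
by move=> x Xx; exists 1%N, (fun=> 1), (fun=> x); rewrite big_ord1 mul1r.
Qed.

Lemma ideal_gen_is_ideal X : is_ideal (ideal_gen X).
Proof.
split.
- by exists 0%N, (fun=> 0), (fun=> 0); split; [case | rewrite big_ord0].
- move=> _ _ [r [a [x [Xx ->]]]] [s [b [y [Xy ->]]]].
  exists (r + s)%N, (fun i => match split i with inl j => a j | inr j => b j end),
    (fun i => match split i with inl j => x j | inr j => y j end).
  split=> [i|]; first by case: (split i).
  rewrite big_split_ord /=; congr (_ + _); apply: eq_bigr => i _.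
    by rewrite (unsplitK (inl i)).
  by rewrite (unsplitK (inr i)).
- move=> c _ [r [a [x [Xx ->]]]]; exists r, (fun i => c * a i), x.
  by split=> //; rewrite mulr_sumr; apply: eq_bigr => i _; rewrite mulrA.
Qed.

Lemma ideal_gen_min X I : is_ideal I -> X `<=` I -> ideal_gen X `<=` I.
Proof.
move=> hI XI _ [r [a [x [Xx ->]]]]; apply: is_ideal_sum => // i _.
by apply: is_idealMl => //; exact/XI/Xx.
Qed.

Lemma ideal_mulP I J a b : I a -> J b -> ideal_mul I J (a * b).
Proof. by move=> Ia Jb; apply: ideal_genS; exists a, b. Qed.

Lemma ideal_mul_min I J K :
  is_ideal K -> (forall a b, I a -> J b -> K (a * b)) -> ideal_mul I J `<=` K.
Proof. by move=> hK h; apply: ideal_gen_min => // _ [a [b [Ia Jb ->]]]; exact: h. Qed.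

Lemma ideal_exp_is_ideal I m : is_ideal (ideal_exp I m).
Proof. by case: m => [|m] //=; exact: ideal_gen_is_ideal. Qed.

Lemma ideal_expD I m n a b :
  ideal_exp I m a -> ideal_exp I n b -> ideal_exp I (m + n) (a * b).
Proof.
elim: m a => [|m IHm] a; first by move=> _ Ib; apply: is_idealMl (ideal_exp_is_ideal _ _) Ib.
move=> Ia Ib; rewrite addSn /=.
suff : ideal_mul I (ideal_exp I m) `<=` [set c | ideal_exp I (m + n).+1 (c * b)] by apply.
apply: ideal_mul_min.
  split=> [|x y|c x] /=.
  - by rewrite mul0r; exact: is_ideal0 (ideal_exp_is_ideal _ _.+1).
  - by rewrite mulrDl; exact: is_idealD (ideal_exp_is_ideal _ _.+1).
  - by rewrite -mulrA; exact: is_idealMl (ideal_exp_is_ideal _ _.+1).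
by move=> x y Ix Iy /=; rewrite -mulrA; apply: ideal_mulP => //; exact: IHm.
Qed.

Lemma ideal_expS_sub I m : ideal_exp I m.+1 `<=` ideal_exp I m.
Proof.
apply: ideal_mul_min (ideal_exp_is_ideal _ _) _ => a b _ Ib.
exact: is_idealMl (ideal_exp_is_ideal _ _) Ib.
Qed.

Lemma ideal_exp_leq I m n : (m <= n)%N -> ideal_exp I n `<=` ideal_exp I m.
Proof.
move=> /subnK <-; elim: (n - m)%N => [|d IHd] //.
by rewrite addSn; apply: subset_trans IHd; exact: ideal_expS_sub.
Qed.

Lemma ideal_expX I m a : I a -> ideal_exp I m (a ^+ m).
Proof.
by move=> Ia; elim: m => [|m IHm] //; rewrite exprS; exact: ideal_mulP.
Qed.

Lemma ideal_exp1 I a : I a -> ideal_exp I 1 a.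
Proof. by move=> Ia; rewrite -[a]mulr1; exact: ideal_mulP. Qed.

Lemma ideal_exp_sub I m : is_ideal I -> (0 < m)%N -> ideal_exp I m `<=` I.
Proof.
case: m => // m hI _; apply: ideal_mul_min => // a b Ia _; exact: is_idealMr.
Qed.

Lemma primeX P a m : prime_ideal P -> P (a ^+ m) -> P a.
Proof.
case=> _ P1 PM; elim: m => [/P1 //|m IHm]; rewrite exprS => /PM [] //.
Qed.

Lemma primeMn P a b : prime_ideal P -> ~ P a -> ~ P b -> ~ P (a * b).
Proof. by case=> _ _ PM Pa Pb /PM []. Qed.

Lemma prime_prod P (T : Type) (r : seq T) (C : pred T) (F : T -> R) :
  prime_ideal P -> (forall i, C i -> ~ P (F i)) -> ~ P (\prod_(i <- r | C i) F i).
Proof.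
move=> hP PF; apply: (big_ind (fun x => ~ P x)) => //; first by case: hP.
by move=> x y; exact: primeMn.
Qed.

Lemma primary_radical_prime Q : primary_ideal Q -> prime_ideal (radical Q).
Proof.
move=> [hQ Q1 QM]; split.
- split=> [|x y [m Qx] [m' Qy]|a x [m Qx]].
  + by exists 1%N; rewrite expr1; exact: is_ideal0.
  + exists (m + m')%N; rewrite exprDn; apply: is_ideal_sum => // i _.
    rewrite -mulr_natl; apply: is_idealMl => //.
    case: (leqP m' i) => le_i.
      by rewrite -(subnK le_i) exprD mulrA; exact: is_idealMl.
    have le_m : (m <= m + m' - i)%N by rewrite -addnBA ?leq_addr // ltnW.
    by rewrite -(subnK le_m) exprD mulrAC; exact: is_idealMl.
  + by exists m; rewrite exprMn; exact: is_idealMl.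
- by case=> m; rewrite expr1n.
- move=> a b [m]; rewrite exprMn => /QM [Qa|[m' Qb]]; first by left; exists m.
  by right; exists (m * m')%N; rewrite exprM.
Qed.

Lemma sub_radical Q : Q `<=` radical Q.
Proof. by move=> x Qx; exists 1%N; rewrite expr1. Qed.

Lemma primaryI Q Q' : primary_ideal Q -> primary_ideal Q' ->
  radical Q = radical Q' ->
  primary_ideal (Q `&` Q') /\ radical (Q `&` Q') = radical Q.
Proof.
move=> pQ pQ' radE.
have radI : radical (Q `&` Q') = radical Q.
  apply/seteqP; split=> x; first by case=> m [Qx _]; exists m.
  move=> rx; have [m' Q'x] : radical Q' x by rewrite -radE.
  case: rx => m Qx; exists (m + m')%N; rewrite exprD; split.
    by apply: is_idealMr => //; case: pQ.
  by apply: is_idealMl => //; case: pQ'.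
split=> //; case: pQ => hQ Q1 QM; case: pQ' => hQ' Q'1 Q'M; split.
- split=> [|x y [? ?] [? ?]|a x [? ?]]; split;
    by [exact: is_ideal0 | exact: is_idealD | exact: is_idealMl].
- by case.
- move=> a b [/QM [Qa|rb] /Q'M [Q'a|rb']]; rewrite radI; try by right.
    by left.
  by right; rewrite radE.
Qed.

(** One repeated step per ascending chain is asked for instead of stabilisation; thinning out a
    chain shows that the two conditions are equivalent. *)
Definition noetherian :=
  forall c : nat -> set R, (forall i, is_ideal (c i)) ->
    (forall i, c i `<=` c i.+1) -> exists i, c i.+1 `<=` c i.

Hypothesis noethR : noetherian.

(** A counterexample always has a strictly larger counterexample above it, and iterating a choice of
    these builds a strictly ascending chain. *)
Lemma noetherian_ind (Pr : set R -> Prop) :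
  (forall I, is_ideal I ->
     (forall J, is_ideal J -> I `<=` J -> ~ (J `<=` I) -> Pr J) -> Pr I) ->
  forall I, is_ideal I -> Pr I.
Proof.
move=> ind I hI; apply: contrapT => nPrI.
pose bad := {J | is_ideal J /\ ~ Pr J}.
have ex (B : bad) : exists B' : bad, sval B `<=` sval B' /\ ~ (sval B' `<=` sval B).
  case: B => J [hJ nPrJ]; apply: contrapT => none.
  apply: (nPrJ); apply: ind => // K hK JK nKJ; apply: contrapT => nPrK.
  by apply: none; exists (exist _ K (conj hK nPrK)).
have [next nextP] := choice ex.
pose c i := sval (iter i next (exist _ I (conj hI nPrI))).
have [i] : exists i, c i.+1 `<=` c i.
  apply: noethR => i; rewrite /c; first by case: (iter _ _ _) => J [].
  by case: (nextP (iter i next (exist _ I (conj hI nPrI)))).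
by case: (nextP (iter i next (exist _ I (conj hI nPrI)))).
Qed.

Definition colon I b : set R := [set c | I (c * b)].

Lemma colon_is_ideal I b : is_ideal I -> is_ideal (colon I b).
Proof.
move=> hI; split=> [|x y|a x]; rewrite /colon /=.
- by rewrite mul0r; exact: is_ideal0.
- by rewrite mulrDl; exact: is_idealD.
- by rewrite -mulrA; exact: is_idealMl.
Qed.

Lemma colon_stable I b : is_ideal I ->
  exists2 m, (0 < m)%N & forall c n, I (c * b ^+ (m + n)) -> I (c * b ^+ m).
Proof.
move=> hI; have [i st] : exists i, colon I (b ^+ i.+1) `<=` colon I (b ^+ i).
  apply: (noethR (c := fun i => colon I (b ^+ i))) => i; first exact: colon_is_ideal.
  by move=> c; rewrite /colon /= exprS mulrCA; exact: is_idealMl.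
have st' c n : I (c * b ^+ (i + n)) -> I (c * b ^+ i).
  elim: n c => [|n IHn] c; first by rewrite addn0.
  rewrite addnS exprS mulrA => /IHn; rewrite -mulrA -exprS; exact: st.
(* Taking [i.+1] keeps the exponent positive, so that [lasker_noether] can split off a factor
   [b]. *)
exists i.+1 => // c n; rewrite addSnnS => /st'.
by rewrite exprSr mulrA; exact: is_idealMr.
Qed.

Definition has_primary_dec I (r : nat) :=
  exists q : 'I_r -> set R, (forall i, primary_ideal (q i)) /\ I = \bigcap_i q i.

(** Noetherian induction. If [a * b] witnesses that [I] is not primary and [m] is a stable exponent
    for [b], then I = (I : b^m) ∩ (I + (b^m)); the first ideal gains [a], the second gains
    [b ^+ m]. *)
Lemma lasker_noether I : is_ideal I -> exists r, has_primary_dec I r.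
Proof.
move: I; apply: noetherian_ind => I hI IH.
have [I1|nI1] := pselect (I 1).
  exists 0%N, (fun=> set0); split=> [[]//|].
  by apply/seteqP; split=> [x _ []//|x _]; rewrite -[x]mulr1; exact: is_idealMl.
have [pI|npI] := pselect (primary_ideal I).
  exists 1%N, (fun=> I); split=> //.
  by apply/seteqP; split=> [x Ix i|x /(_ ord0 Logic.I)].
have [a [b [Iab nIa nrIb]]] : exists a b, [/\ I (a * b), ~ I a & ~ radical I b].
  apply: contrapT => none; apply: npI; split=> // a b Iab.
  by apply: contrapT => /not_orP [nIa nrIb]; apply: none; exists a, b.
have [m m_gt0 stab] := colon_stable b hI.
pose J := [set f | exists u c, I u /\ f = u + c * b ^+ m].
have hJ : is_ideal J.
  split=> [|_ _ [u [c [Iu ->]]] [v [d [Iv ->]]]|e _ [u [c [Iu ->]]]].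
  - by exists 0, 0; rewrite mul0r addr0; split=> //; exact: is_ideal0.
  - by exists (u + v), (c + d); rewrite mulrDl addrACA; split=> //; exact: is_idealD.
  - by exists (e * u), (e * c); rewrite mulrDr mulrA; split=> //; exact: is_idealMl.
have [r1 [q1 [pq1 E1]]] : exists r, has_primary_dec (colon I (b ^+ m)) r.
  apply: IH; [exact: colon_is_ideal | |].
    by move=> x Ix; exact: is_idealMr.
  move=> /(_ a); rewrite /colon /= -(prednK m_gt0) exprS mulrA => h.
  by apply/nIa/h; exact: is_idealMr.
have [r2 [q2 [pq2 E2]]] : exists r, has_primary_dec J r.
  apply: IH => //; first by move=> x Ix; exists x, 0; rewrite mul0r addr0.
  move=> h; apply: nrIb; exists m; apply: h.
  by exists 0, 1; rewrite mul1r add0r; split=> //; exact: is_ideal0.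
exists (r1 + r2)%N,
  (fun i => match split i with inl j => q1 j | inr j => q2 j end); split.
  by move=> i; case: (split i).
(* If x = u + c b^m with u in I and x b^m lies in I, then c b^(2m) lies in I, so c b^m does by
   stability. *)
have -> : I = colon I (b ^+ m) `&` J.
  apply/seteqP; split=> x.
    by move=> Ix; split; [exact: is_idealMr | exists x, 0; rewrite mul0r addr0].
  rewrite /colon /= => -[+ [u [c [Iu Ex]]]]; rewrite Ex mulrDl => h.
  apply: is_idealD => //; apply: (stab c m); rewrite exprD mulrA.
  rewrite -[X in I X](addKr (u * b ^+ m)) addrC; apply: is_idealB => //.
  exact: is_idealMr.
rewrite E1 E2; apply/seteqP; split=> x.
  by move=> [h1 h2] i _; case: (split i) => j; [exact: h1 | exact: h2].
move=> h; split=> j _.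
  by have := h (lshift r2 j) Logic.I; rewrite (unsplitK (inl j)).
by have := h (rshift r1 j) Logic.I; rewrite (unsplitK (inr j)).
Qed.

(** Take a decomposition with the fewest components: merging two with equal radicals, or dropping a
    redundant one, would shorten it. *)
Lemma irredundant_dec_exists I : is_ideal I ->
  exists r (q : 'I_r -> set R), irredundant_primary_decomposition I q.
Proof.
move=> hI; have exr : exists r, `[< has_primary_dec I r >].
  by have [r hr] := lasker_noether hI; exists r; apply/asboolP.
case: (ex_minnP exr) => r /asboolP [q [pq EI]] minr; exists r, q.
have notless r' : (r' < r)%N -> ~ has_primary_dec I r'.
  by move=> lt_r' dec; have := minr r' (asboolT dec); rewrite leqNgt lt_r'.
case: r => [|r] in q pq EI minr notless *; first by split=> // -[].
split=> // [i j radE|i sub].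
- apply: contrapT => /eqP ij; apply: (notless r) => //.
  have [i' Ei|] := unliftP j i; last by move/eqP: ij.
  have [pI _] := primaryI (pq i) (pq j) radE.
  exists (fun k => if k == i' then q i `&` q j else q (lift j k)); split.
    by move=> k; case: eqP.
  rewrite EI; apply/seteqP; split=> x h k _.
    by case: eqP => _; [split; exact: h | exact: h].
  have [k' ->|->] := unliftP j k.
    have := h k' Logic.I; case: eqP => // -> [].
    by rewrite Ei.
  by have := h i' Logic.I; rewrite eqxx => -[].
- apply: (notless r) => //; exists (fun k => q (lift i k)); split=> //.
  rewrite EI; apply/seteqP; split=> x h k _; first exact: h.
  have [k' ->|->] := unliftP i k; first exact: h.
  apply: sub => j /= /eqP ji; have [j' ->|/ji //] := unliftP i j; exact: h.
Qed.

End IdealTheory.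

(** * Symbolic powers and the splitting criterion *)

(* The elements of R that land in [A R_P] in the localisation at [P]. *)
Definition loc (R : comNzRingType) (P A : set R) : set R :=
  [set f | exists2 s, ~ P s & A (s * f)].

Section Localisation.
Variables (R : comNzRingType) (P : set R).
Hypothesis prP : prime_ideal P.
Implicit Types (A B I J Q : set R).

Lemma loc_is_ideal A : is_ideal A -> is_ideal (loc P A).
Proof.
move=> hA; split=> [|x y [s Ps As] [t Pt At]|a x [s Ps As]].
- by exists 1; [case: prP | rewrite mulr0; exact: is_ideal0].
- exists (s * t); first exact: primeMn.
  rewrite mulrDr; apply: is_idealD => //; last by rewrite -mulrA; exact: is_idealMl.
  by rewrite mulrAC; exact: is_idealMr.
- by exists s => //; rewrite mulrCA; exact: is_idealMl.
Qed.

Lemma sub_loc A : A `<=` loc P A.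
Proof. by move=> x Ax; exists 1; [case: prP | rewrite mul1r]. Qed.

Lemma loc_mono A B : A `<=` B -> loc P A `<=` loc P B.
Proof. by move=> AB x [s Ps As]; exists s => //; exact: AB. Qed.

Lemma loc_cancel A s f : ~ P s -> loc P A (s * f) -> loc P A f.
Proof.
by move=> Ps [t Pt At]; exists (t * s); [exact: primeMn | rewrite -mulrA].
Qed.

Lemma loc_loc A : loc P (loc P A) `<=` loc P A.
Proof. by move=> f [s Ps As]; exact: loc_cancel As. Qed.

Lemma locM A B C a b : (forall x y, A x -> B y -> C (x * y)) ->
  loc P A a -> loc P B b -> loc P C (a * b).
Proof.
move=> ABC [s Ps As] [t Pt Bt]; exists (s * t); first exact: primeMn.
by rewrite mulrACA; exact: ABC.
Qed.

Lemma loc_exp_prod I (T : Type) (r : seq T) (F : T -> R) (e : T -> nat) :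
  (forall i, (0 < e i)%N -> loc P I (F i)) ->
  loc P (ideal_exp I (\sum_(i <- r) e i)) (\prod_(i <- r) F i ^+ e i).
Proof.
move=> h; elim: r => [|i r IHr]; first by rewrite !big_nil; exact: sub_loc.
rewrite !big_cons; apply: locM IHr; first exact: ideal_expD.
elim: (e i) (h i) => [|m IHm] {}h; first exact: sub_loc.
rewrite exprS -add1n; apply: locM; first exact: ideal_expD.
  by apply: loc_mono (h _) => // x; exact: ideal_exp1.
by apply: IHm => _; exact: h.
Qed.

(** The prime [P] contains the intersection of the [q i], hence some radical, which equals [P] by
    minimality. Each other component has an element outside [P], and the product of these carries
    [q i] into [A]. *)
Lemma minimal_prime_component A r (q : 'I_r -> set R) :
  minimal_prime A P -> irredundant_primary_decomposition A q ->
  exists2 i, radical (q i) = P & q i `<=` loc P A.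
Proof.
move=> [_ AP minP] [pq EA radq _].
have Aq i : A `<=` q i by rewrite EA => x; apply.
have radP j : radical (q j) `<=` P -> radical (q j) = P.
  move=> sub; apply: minP => //; first exact: primary_radical_prime.
  exact: subset_trans (Aq j) (@sub_radical _ _).
have [i radi] : exists i, radical (q i) = P.
  apply: contrapT => none.
  have ex i : exists s, q i s /\ ~ P s.
    apply: contrapT => nos; apply: none; exists i; apply: radP => x [m qx].
    apply: contrapT => nPx; apply: nos; exists (x ^+ m); split=> //.
    by move/(primeX prP).
  have [s sP] := choice ex.
  apply: (@prime_prod _ P _ (index_enum 'I_r) predT s prP) => [j _|].
    by case: (sP j).
  apply: AP; rewrite EA => j _; rewrite (bigD1 j) //=; apply: is_idealMr.
    by case: (pq j).
  by case: (sP j).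
exists i => // f qf.
have ex j : exists s, ~ P s /\ (j != i -> q j s).
  have [->|ji] := eqVneq j i; first by exists 1; split=> //; case: prP.
  apply: contrapT => nos; move/eqP: ji; apply; apply: radq; rewrite radi.
  apply: radP => x [m qx]; apply: contrapT => nPx; apply: nos.
  by exists (x ^+ m); split=> //; move/(primeX prP).
have [s sP] := choice ex.
exists (\prod_j s j); first by apply: prime_prod => // j _; case: (sP j).
rewrite EA => j _; have hq : is_ideal (q j) by case: (pq j).
have [->|ji] := eqVneq j i; first by apply: is_idealMl => //; case: (pq i).
apply: is_idealMr => //; rewrite (bigD1 j) //=; apply: is_idealMr => //.
by case: (sP j) => _; apply.
Qed.

End Localisation.

Section SymbolicPower.
Variable R : comNzRingType.
Hypothesis noethR : noetherian R.
Implicit Types (I P Q : set R).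

Lemma minimal_prime_nilpotent I P z :
  is_ideal I -> minimal_prime I P -> P z -> exists m, loc P I (z ^+ m).
Proof.
move=> hI mP Pz; have [r [q dec]] := irredundant_dec_exists noethR hI.
have prP : prime_ideal P by case: mP.
have [i radi sub] := minimal_prime_component prP mP dec.
by move: Pz; rewrite -radi => -[m /sub]; rewrite radi; exists m.
Qed.

Lemma minimal_prime_exp I P m :
  is_ideal I -> minimal_prime I P -> minimal_prime (ideal_exp I m.+1) P.
Proof.
move=> hI [prP IP minP]; split=> //.
  by apply: subset_trans IP; exact: ideal_exp_sub.
move=> P' prP' IP' P'P; apply: minP => // x Ix.
by apply: (primeX (m := m.+1) prP'); apply: IP'; exact: ideal_expX.
Qed.

(** This trades primary components for localisation. Forwards, a component exists and lies in
    [loc P]; backwards, a denominator outside P = rad Q can be cancelled in the primary ideal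
    [Q]. *)
Lemma symbolic_powerP I m f : is_ideal I ->
  symbolic_power I m f <->
  (forall P, minimal_prime I P -> loc P (ideal_exp I m) f).
Proof.
move=> hI; case: m => [|m].
  by split=> // _ P [prP _ _]; exact: sub_loc.
have hIm := ideal_exp_is_ideal I m.+1; split=> [h P mP|h P Q mP].
  have prP : prime_ideal P by case: mP.
  have mP' := minimal_prime_exp m hI mP.
  have [r [q dec]] := irredundant_dec_exists noethR hIm.
  have [i radi sub] := minimal_prime_component prP mP' dec.
  by apply/sub/(h P (q i)) => //; exists r, q; split=> //; exists i.
move=> [r [q [[pq EI _ _] [i [qi radQ]]]]]; have [s Ps Is] := h P mP.
have : q i (s * f) by move: Is; rewrite EI; apply.
rewrite qi mulrC; have [_ _ QM] := pq i; move: QM; rewrite qi => QM.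
by move/QM => []; rewrite ?radQ // => /Ps.
Qed.

Lemma symbolic_power_is_ideal I m : is_ideal I -> is_ideal (symbolic_power I m).
Proof.
move=> hI; have hl P (mP : minimal_prime I P) : is_ideal (loc P (ideal_exp I m)).
  by apply: loc_is_ideal; [case: mP | exact: ideal_exp_is_ideal].
split=> [|x y|a x]; rewrite !symbolic_powerP //.
- by move=> P mP; exact: is_ideal0 (hl P mP).
- by move=> hx hy P mP; apply: is_idealD (hl P mP) _ _; [exact: hx | exact: hy].
- by move=> hx P mP; apply: is_idealMl (hl P mP) _; exact: hx.
Qed.

End SymbolicPower.

(** The summand is the ceiling of e_i / p. Multiplied by p the ceilings sum to at least mp + 1, so
    their sum exceeds m. *)
Lemma pigeonhole_ceil (N p m : nat) (e : 'I_N -> nat) : (0 < p)%N ->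
  \sum_i e i = (m * p + 1)%N -> (m < \sum_i (e i + p.-1) %/ p)%N.
Proof.
move=> p_gt0 sum_e; rewrite -(ltn_pmul2l p_gt0).
apply: leq_trans (_ : \sum_i e i <= _)%N; first by rewrite sum_e addn1 mulnC.
rewrite big_distrr /=; apply: leq_sum => i _; rewrite mulnC.
have := divn_eq (e i + p.-1) p; have := ltn_pmod (e i + p.-1) p_gt0; lia.
Qed.

(** * A criterion for symbolic F-splitting *)

Section Criterion.
Variables (R : comNzRingType) (p : nat) (pcharR : p \in [pchar R]).
Hypotheses (noethR : noetherian R)
  (redR : forall (x : R) (m : nat), x ^+ m = 0 -> x = 0).
Variables (N : nat) (z : 'I_N -> R) (Phi : R -> R) (I : set R).
Hypotheses (PhiD : {morph Phi : x y / x + y})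
  (PhiZ : forall a x, Phi (a ^+ p * x) = a * Phi x)
  (Phi1 : Phi ((\prod_i z i) ^+ p.-1) = 1) (hI : is_ideal I)
  (z_loc : forall P i, minimal_prime I P -> P (z i) -> loc P I (z i))
  (I_loc : forall P, minimal_prime I P ->
    I `<=` loc P (ideal_gen [set f | exists2 i, P (z i) & f = z i])).

(** The r-th power of the ideal generated by the [z i] in [P], given by exponent vectors so that
    [pigeonhole_ceil] applies to its generators. *)
Let monomials P r : set R := ideal_gen [set f | exists e : 'I_N -> nat,
  [/\ forall i, (0 < e i)%N -> P (z i), \sum_i e i = r &
      f = \prod_i z i ^+ e i]].

Let exp_loc_monomials P r : minimal_prime I P ->
  ideal_exp I r `<=` loc P (monomials P r).
Proof.
move=> mP; have prP : prime_ideal P by case: mP.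
have hM s : is_ideal (monomials P s) by exact: ideal_gen_is_ideal.
elim: r => [|r IHr].
  move=> f _; rewrite -[f]mulr1; apply: is_idealMl; first exact: loc_is_ideal.
  apply/sub_loc => //; apply: ideal_genS; exists (fun=> 0%N).
  by rewrite sum_nat_const muln0 big1 // => i _; rewrite expr0.
apply: ideal_mul_min => [|a b /(I_loc mP) la /IHr lb].
  exact: loc_is_ideal.
apply: (locM prP _ la lb) => x y {}la {}lb.
suff : ideal_gen [set f | exists2 i, P (z i) & f = z i]
    `<=` colon (monomials P r.+1) y by apply.
apply: ideal_gen_min => [|_ [i Pz ->]]; first exact: colon_is_ideal.
rewrite /colon /= mulrC.
suff : monomials P r `<=` colon (monomials P r.+1) (z i) by apply.
apply: ideal_gen_min => [|_ [e [eP sum_e ->]]]; first exact: colon_is_ideal.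
apply: ideal_genS; exists (fun j => (e j + (j == i))%N); split.
- by move=> j; case: eqP => [->|_] //; rewrite addn0; exact: eP.
- rewrite big_split /= sum_e -addn1; congr addn.
  by rewrite (bigD1 i) //= eqxx big1 // => j /negPf ->.
- rewrite [RHS](eq_bigr (fun j => z j ^+ e j * z j ^+ (j == i))); last first.
    by move=> j _ /=; rewrite exprD.
  rewrite big_split /=; congr (_ * _).
  by rewrite (bigD1 i) //= eqxx big1 ?mulr1 // => j /negPf ->.
Qed.

(** The Frobenius power A^[p]. *)
Let frob (A : set R) : set R := ideal_gen [set f | exists2 a, A a & f = a ^+ p].

Let p_gt0 : (0 < p)%N. Proof. exact: prime_gt0 (pcharf_prime pcharR). Qed.

(** Multiplying a monomial of degree mp + 1 by the (p-1)-st power of the product of all [z i] raises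
    each exponent e_i to at least p b_i, where b_i is the ceiling of e_i / p. The b_i sum to more
    than m, so the p-th power that splits off has its base in I^(m+1) locally. *)
Let loc_frob P m f : minimal_prime I P ->
  loc P (ideal_exp I (m * p + 1)) f ->
  loc P (frob (ideal_exp I m.+1)) ((\prod_i z i) ^+ p.-1 * f).
Proof.
move=> mP; have prP : prime_ideal P by case: mP.
have hF : is_ideal (frob (ideal_exp I m.+1)) by exact: ideal_gen_is_ideal.
have hL := loc_is_ideal prP hF.
move=> /(loc_mono (@exp_loc_monomials P _ mP)) /(loc_loc prP) lf.
rewrite mulrC; suff : loc P (monomials P (m * p + 1))
    `<=` colon (loc P (frob (ideal_exp I m.+1))) ((\prod_i z i) ^+ p.-1) by apply.
move=> {lf}x [s Ps Ms]; rewrite /colon /=; apply: (loc_cancel prP Ps).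
rewrite mulrA; move: {x s Ps} (s * x) Ms; apply: ideal_gen_min.
  exact: colon_is_ideal.
move=> _ [e [eP sum_e ->]]; rewrite /colon /= -prodrXl -big_split /=.
pose b i := ((e i + p.-1) %/ p)%N.
rewrite (eq_bigr (fun i => (z i ^+ b i) ^+ p * z i ^+ ((e i + p.-1) %% p))); last first.
  by move=> i _; rewrite -exprM -!exprD -divn_eq.
rewrite big_split /=; apply: is_idealMr => //; rewrite prodrXl.
have : loc P (ideal_exp I m.+1) (\prod_i z i ^+ b i).
  apply: loc_mono (ideal_exp_leq _) _ _.
    exact: (pigeonhole_ceil p_gt0 sum_e).
  (* A positive ceiling forces a positive [e i], so only factors in [P] occur. *)
  apply: loc_exp_prod => // i; rewrite divn_gt0 // => bi; apply: z_loc => //.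
  by apply: eP; move: p_gt0 bi; lia.
case=> s Ps Is; exists (s ^+ p); first by move/(primeX prP).
by rewrite -exprMn; apply: ideal_genS; exists (s * \prod_i z i ^+ b i).
Qed.

(** The splitting is [Phi] after multiplication by the (p-1)-st power of the product of the [z i].
    By [loc_frob] it is applied locally to an element of the Frobenius power of I^(m+1), and [Phi]
    maps w d^p to d Phi(w). *)
Lemma symbolic_F_split_criterion : symbolic_F_split pcharR I.
Proof.
have Phi0 : Phi 0 = 0 by apply: (addrI (Phi 0)); rewrite -PhiD !addr0.
split.
- by move=> m; exact: symbolic_power_is_ideal.
- by [].
- move=> m f; rewrite !symbolic_powerP // => h P mP.
  exact: loc_mono (@ideal_expS_sub _ _ _) _ (h P mP).
- move=> m1 m2; apply: ideal_mul_min; first exact: symbolic_power_is_ideal.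
  move=> a b; rewrite !symbolic_powerP // => ha hb P mP.
  have prP : prime_ideal P by case: mP.
  by apply: (locM prP _ (ha P mP) (hb P mP)); exact: ideal_expD.
pose phi (x : pth_roots pcharR) : R^o := Phi ((\prod_i z i) ^+ p.-1 * (x : R)).
have phi_linear : linear phi.
  move=> a x y; rewrite /phi.
  rewrite -[LHS]/(Phi (_ * (a ^+ p * (x : R) + (y : R)))).
  by rewrite mulrDr PhiD mulrCA PhiZ.
pose phiL := HB.pack_for {linear (pth_roots pcharR) -> R^o} phi
  (GRing.isLinear.Build _ _ _ _ phi phi_linear).
exists phiL; split=> [a|m x [a Ia xa]].
  rewrite -[LHS]/(Phi (_ * (a ^+ p * 1))).
  by rewrite mulr1 mulrC PhiZ Phi1 mulr1.
have {xa Ia} Ix : symbolic_power I (m * p + 1) (x : R).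
  (* In the encoding of R^(1/p), membership of [x] reads x^p = a^p; Frobenius is injective because
     [R] is reduced. *)
  suff -> : (x : R) = a by [].
  apply/eqP; rewrite -subr_eq0; apply/eqP; apply: (redR (m := p)).
  rewrite -(pFrobenius_autE pcharR) pFrobenius_autB_comm; last exact: mulrC.
  rewrite !pFrobenius_autE; move: xa.
  rewrite -[LHS]/((x : R) ^+ p) -[a%:A]/(a ^+ p * 1) mulr1 => ->.
  by rewrite subrr.
rewrite -[phiL x]/(Phi (_ * (x : R))).
move: Ix; rewrite !symbolic_powerP // => h P mP.
have prP : prime_ideal P by case: mP.
have [s Ps Fs] := loc_frob mP (h P mP); exists s => //.
(* The denominator [s] enters [Phi] as [s ^+ p]; one of its factors moves the argument into the
   Frobenius power. *)
rewrite -PhiZ -(prednK p_gt0) exprS mulrC mulrA -[_ * s](mulrC s).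
have hIm := ideal_exp_is_ideal I m.+1.
move: Fs; set u := _ * (x : R) => Fs.
suff : frob (ideal_exp I m.+1) `<=`
    [set v | forall w, ideal_exp I m.+1 (Phi (w * v))].
  by move=> /(_ _ Fs (s ^+ p.-1)); rewrite mulrCA [_ * u]mulrC mulrA.
apply: ideal_gen_min.
  split=> [w|v w hv hw c|d v hv c].
  - by rewrite mulr0 Phi0; exact: is_ideal0.
  - by rewrite mulrDr PhiD; apply: is_idealD.
  - by rewrite mulrA.
by move=> _ [d Id ->] w; rewrite mulrC PhiZ; exact: is_idealMr.
Qed.

End Criterion.

(** * Polynomial rings: the basis theorem and the Cartier map *)

Lemma nondecreasing_subseq (u : nat -> nat) : exists psi : nat -> nat,
  (forall i, (psi i < psi i.+1)%N) /\ (forall i j, (i <= j)%N -> (u (psi i) <= u (psi j))%N).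
Proof.
have ex N : exists m, (N <= m)%N /\ forall k, (N <= k)%N -> (u m <= u k)%N.
  have exv : exists v, `[< exists2 m, (N <= m)%N & u m = v >].
    by exists (u N); apply/asboolP; exists N.
  case: (ex_minnP exv) => v /asboolP [m Nm <-] minv; exists m; split=> // k Nk.
  by apply: minv; apply/asboolP; exists k.
have [next nextP] := choice ex.
(* Each chosen index minimises [u] over all indices from some bound on, hence over all later
   choices. *)
pose psi i := iter i (fun m => next m.+1) (next 0%N).
have psiS i : (psi i < psi i.+1)%N by have [] := nextP (psi i).+1.
exists psi; split=> // i j le_ij.
have [N [le_N psiN]] : exists N, (N <= psi i)%N /\ psi i = next N.
  case: i {le_ij} => [|i]; first by exists 0%N.
  by exists (psi i).+1; split.
have le_psi : (psi i <= psi j)%N.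
  by apply: (@homo_leq nat psi leq) => // [a b c|m]; [exact: leq_trans | exact/ltnW].
by rewrite {1}psiN; apply: (proj2 (nextP N)); exact: leq_trans le_psi.
Qed.

(** Pass to nondecreasing subsequences one coordinate after another, then compare the first two
    remaining terms. *)
Lemma dickson (n : nat) (f : nat -> 'X_{1..n}) :
  exists i j, (i < j)%N /\ (f i <= f j)%MM.
Proof.
suff [psi [psiS psiP]] : exists psi : nat -> nat, (forall i, (psi i < psi i.+1)%N) /\
    forall c, c \in enum 'I_n -> forall i j, (i <= j)%N -> (f (psi i) c <= f (psi j) c)%N.
  exists (psi 0%N), (psi 1%N); split=> //; apply/mnm_lepP => c.
  by apply: psiP; rewrite ?mem_enum.
elim: (enum 'I_n) => [|c0 s [psi [psiS psiP]]]; first by exists id.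
have [chi [chiS chiP]] := nondecreasing_subseq (fun i => f (psi i) c0).
have le_chi i j : (i <= j)%N -> (chi i <= chi j)%N.
  by move=> ij; apply: (@homo_leq nat chi leq) => // [a b c|m];
    [exact: leq_trans | exact/ltnW].
have lt_psi i j : (i < j)%N -> (psi i < psi j)%N.
  exact: (homo_ltn ltn_trans psiS).
exists (psi \o chi); split=> [i|c]; first exact: lt_psi.
by rewrite inE => /orP [/eqP ->|/psiP psic] i j ij; [exact: chiP | exact/psic/le_chi].
Qed.

Lemma mlead_minimal (n : nat) (k : fieldType) (X : set {mpoly k[n]}) :
  X !=set0 -> exists2 f, X f & forall h, X h -> ~~ (mlead h < mlead f)%O.
Proof.
case=> f Xf; move: {2}(mlead f) (erefl (mlead f)) => m.
elim/(@ltmwf n): m f Xf => m IHm f Xf Ef.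
have [minf|] := pselect (forall h, X h -> ~~ (mlead h < mlead f)%O); first by exists f.
move=> /existsNP [h /not_implyP [Xh /negP]]; rewrite negbK => lt_hf.
by apply: (IHm (mlead h)) (erefl _) => //; rewrite -Ef.
Qed.

(** In a strictly ascending chain choose f_i in c_(i+1) but not in c_i with minimal leading
    monomial. Dickson gives i < j with lead(f_i) dividing lead(f_j), and cancelling the leading term
    of f_j by a multiple of f_i contradicts the minimality of f_j. *)
Lemma mpoly_noetherian (n : nat) (k : fieldType) : noetherian {mpoly k[n]}.
Proof.
move=> c hc cS; apply: contrapT => /forallNP nst.
have ex i : exists f, [/\ c i.+1 f, ~ c i f &
    forall h, c i.+1 h -> ~ c i h -> ~~ (mlead h < mlead f)%O].
  have [|f [cf ncf] minf] := @mlead_minimal n k (c i.+1 `\` c i).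
    apply: contrapT => /forallNP none; apply: (nst i) => x cx.
    by apply: contrapT => ncx; apply: (none x).
  by exists f; split=> // h ch nch; exact: minf.
have [f fP] := choice ex.
have [i [j [lt_ij le_m]]] := dickson (fun i => mlead (f i)).
have [cfi ncfi _] := fP i; have [cfj ncfj minj] := fP j.
have c_mono : c i.+1 `<=` c j.
  rewrite -(subnK lt_ij); elim: (j - i.+1)%N => [|d IHd] //.
  by rewrite addSn; exact: subset_trans IHd (cS _).
have fi0 : f i != 0 by apply/eqP => E; apply: ncfi; rewrite E; exact: is_ideal0.
have fj0 : f j != 0 by apply/eqP => E; apply: ncfj; rewrite E; exact: is_ideal0.
have lci : mleadc (f i) != 0 by rewrite mleadc_eq0.
pose a := mleadc (f j) / mleadc (f i).
pose h := f j - a *: (f i * 'X_[mlead (f j) - mlead (f i)]).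
have cjg : c j (a *: (f i * 'X_[mlead (f j) - mlead (f i)])).
  rewrite -mul_mpolyC; apply: is_idealMl => //; apply: is_idealMr => //.
  exact: c_mono.
have nch : ~ c j h.
  move=> ch; apply: ncfj; rewrite -[f j](subrK (a *: (f i * 'X_[mlead (f j) - mlead (f i)]))).
  exact: is_idealD.
have ch : c j.+1 h by apply: is_idealB => //; exact: cS.
have h0 : h != 0 by apply/eqP => E; apply: nch; rewrite E; exact: is_ideal0.
have /negP := minj h ch nch; apply.
have E : mlead (a *: (f i * 'X_[mlead (f j) - mlead (f i)])) = mlead (f j).
  rewrite mleadZ; last by rewrite mulf_neq0 ?invr_eq0 // mleadc_eq0.
  rewrite mleadM //; last by rewrite -msupp_eq0 msuppX.
  by rewrite mleadXm addmC submK.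
rewrite lt_neqAle; apply/andP; split; last first.
  by have := mleadB_le (f j) (a *: (f i * 'X_[mlead (f j) - mlead (f i)])); rewrite E joinxx.
apply/eqP => Eh; move: h0; rewrite -mleadc_eq0 Eh mcoeffB mcoeffZ.
rewrite -[X in _ * _@_X](submK le_m) mcoeffMX /a divfK // subrr eqxx //.
Qed.

(** The field may be imperfect, so a complement is chosen: a k^p-subspace U maximal among those
    avoiding 1 satisfies k = U + k^p, and [lam] takes the p-th root of the k^p-component. *)
Lemma pth_root_functional (k : fieldType) (p : nat) : p \in [pchar k] ->
  exists lam : k -> k, [/\ {morph lam : x y / x + y},
    forall c x, lam (c ^+ p * x) = c * lam x & lam 1 = 1].
Proof.
move=> pchark; have p_gt0 := prime_gt0 (pcharf_prime pchark).
have expD (a b : k) : (a + b) ^+ p = a ^+ p + b ^+ p.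
  by rewrite -!(pFrobenius_autE pchark) pFrobenius_autD_comm //; exact: mulrC.
have expB (a b : k) : (a - b) ^+ p = a ^+ p - b ^+ p.
  by rewrite -!(pFrobenius_autE pchark) pFrobenius_autB_comm //; exact: mulrC.
pose sub (U : set k) := [/\ forall x y, U x -> U y -> U (x + y),
  forall c x, U x -> U (c ^+ p * x) & ~ U 1].
have [|U [[UD UZ U1] maxU]] := @Zorn_bigcup k sub.
  move=> F Fsub tot; split=> [x y [A FA Ax] [B FB By]|c x [A FA Ax]|[A FA A1]].
  - case: (tot _ _ FA FB) => [AB|BA].
      by exists B => //; have [+ _ _] := Fsub _ FB; apply=> //; exact: AB.
    by exists A => //; have [+ _ _] := Fsub _ FA; apply=> //; exact: BA.
  - by exists A => //; have [_ + _] := Fsub _ FA; apply.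
  - by have [_ _] := Fsub _ FA.
(* The condition [sub] also holds for the empty set, the union of the empty chain, so 0 is adjoined
   by hand. *)
pose U0 : set k := [set u | u = 0 \/ U u].
have U0D x y : U0 x -> U0 y -> U0 (x + y).
  by move=> [->|Ux] [->|Uy]; rewrite ?add0r ?addr0; [left|right|right|right; exact: UD].
have U0Z c x : U0 x -> U0 (c ^+ p * x).
  by case=> [->|Ux]; [left; rewrite mulr0 | right; exact: UZ].
have U01 : ~ U0 1 by case=> // /eqP; rewrite oner_eq0.
have expN1 : (-1 : k) ^+ p = - 1.
  have := expB 0 1; rewrite sub0r => ->.
  by rewrite expr0n eqn0Ngt p_gt0 expr1n sub0r.
have U0N x : U0 x -> U0 (- x).
  by rewrite -mulN1r -expN1; exact: U0Z.
have dec v : exists d, U0 (v - d ^+ p).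
  pose Uv : set k := [set w | exists u c, U0 u /\ w = u + c ^+ p * v].
  have UvU : U `<=` Uv.
    move=> u Uu; exists u, 0; split; first by right.
    by rewrite expr0n eqn0Ngt p_gt0 mul0r addr0.
  have Uvv : Uv v by exists 0, 1; split; [left | rewrite expr1n mul1r add0r].
  have [Uv'|nUv] := pselect (U v).
    by exists 0; rewrite expr0n eqn0Ngt p_gt0 subr0; right.
  (* By maximality 1 = u + c^p v; here c is nonzero, and d = 1/c works. *)
  have [u [c [U0u E]]] : Uv 1.
    apply: contrapT => nUv1; apply: (maxU Uv).
      by split=> // UvsubU; apply/nUv/UvsubU.
    split=> // [_ _ [u [c [Uu ->]]] [w [d [Uw ->]]]|b _ [u [c [Uu ->]]]].
      by exists (u + w), (c + d); rewrite expD mulrDl addrACA; split=> //; exact: U0D.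
    by exists (b ^+ p * u), (b * c); rewrite exprMn mulrDr mulrA; split=> //; exact: U0Z.
  have c0 : c != 0.
    apply/eqP => c0; apply: U01; rewrite E c0 expr0n eqn0Ngt p_gt0 mul0r addr0 //.
  exists c^-1; rewrite (_ : v - _ = (c^-1) ^+ p * (- u)); first exact/U0Z/U0N.
  rewrite -[u](addrK (c ^+ p * v)) -E opprB mulrBr mulr1; congr (_ - _).
  by rewrite mulrA -exprMn mulVf // expr1n mul1r.
have [lam lamP] := choice dec.
have lamE v d : U0 (v - d ^+ p) -> lam v = d.
  move=> Ud; apply/eqP; rewrite -subr_eq0; apply/eqP; apply: contrapT => /eqP ne0.
  apply: U01; rewrite -(expr1n _ p) -(mulVf ne0) exprMn; apply: U0Z.
  rewrite expB -(subrKA v) addrC -[lam v ^+ p - v]opprB.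
  by apply: U0D => //; exact: U0N.
exists lam; split=> [x y|c x|].
- by apply: lamE; rewrite expD opprD addrACA; exact: U0D.
- by apply: lamE; rewrite exprMn -mulrBr; exact: U0Z.
- by apply: lamE; rewrite expr1n subrr; left.
Qed.

Section CartierMap.
Variables (n : nat) (k : fieldType) (p : nat) (pchark : p \in [pchar k]).
Variable lam : k -> k.
Hypotheses (lamD : {morph lam : x y / x + y})
  (lamZ : forall c x, lam (c ^+ p * x) = c * lam x) (lam1 : lam 1 = 1).

Let p_gt0 : (0 < p)%N. Proof. exact: prime_gt0 (pcharf_prime pchark). Qed.

Definition mshift (m : 'X_{1..n}) : 'X_{1..n} := [multinom m i * p + p.-1 | i < n]%N.

(** The bound [msize f] loses nothing: [mshift] does not lower degrees, so the coefficients read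
    beyond it vanish. *)
Definition cartier (f : {mpoly k[n]}) : {mpoly k[n]} :=
  \sum_(m : 'X_{1..n < msize f}) lam f@_(mshift m) *: 'X_[m].

Lemma mcoeff_cartier f m : (cartier f)@_m = lam f@_(mshift m).
Proof.
have lam0 : lam 0 = 0 by apply: (addrI (lam 0)); rewrite -lamD !addr0.
have [lt_m|le_m] := ltnP (mdeg m) (msize f).
  by rewrite /cartier (mcoeff_mpoly (fun m => lam f@_(mshift m))).
have -> : f@_(mshift m) = 0.
  apply: memN_msupp_eq0; apply: msize_mdeg_ge; apply: leq_trans le_m _.
  rewrite !mdegE; apply: leq_sum => i _; rewrite mnmE.
  by rewrite -[X in (X <= _)%N]addn0 leq_add // leq_pmulr.
rewrite lam0 /cartier raddf_sum big1 //= => u _.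
rewrite mcoeffZ mcoeffX; case: eqP => [E|_]; last by rewrite mulr0.
by have := bmdeg u; rewrite E ltnNge le_m.
Qed.

Lemma cartierD : {morph cartier : f h / f + h}.
Proof. by move=> f h; apply/mpolyP => m; rewrite mcoeffD !mcoeff_cartier mcoeffD lamD. Qed.

Lemma mcoeffMX_eq0 (f : {mpoly k[n]}) u m : ~~ (u <= m)%MM -> (f * 'X_[u])@_m = 0.
Proof.
move=> nle; apply: memN_msupp_eq0; rewrite (perm_mem (msuppMX f u)).
by apply/negP => /mapP [m' _ E]; move: nle; rewrite E lem_addr.
Qed.

(** Frobenius is additive, so [a] may be taken to be a term; for X^u the claim rests on pu <= pm + p
    - 1 being equivalent to u <= m, exponent by exponent. *)
Lemma cartierZ a f : cartier (a ^+ p * f) = a * cartier f.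
Proof.
have pcharM : p \in [pchar {mpoly k[n]}] by rewrite pchar_lalg.
elim/mpolyind: a => [|c u a _ _ IHa].
  rewrite expr0n eqn0Ngt p_gt0 !mul0r.
  by apply: (addrI (cartier 0)); rewrite -cartierD !addr0.
rewrite -(pFrobenius_autE pcharM) pFrobenius_autD_comm; last exact: mulrC.
rewrite !pFrobenius_autE !mulrDl cartierD IHa; congr (_ + _).
apply/mpolyP => m; rewrite mcoeff_cartier.
rewrite exprZn -scalerAl -scalerAl !mcoeffZ lamZ; congr (_ * _).
rewrite mpolyXn [_ * f]mulrC [_ * cartier f]mulrC.
have E : (u *+ p <= mshift m)%MM = (u <= m)%MM.
  apply/mnm_lepP/mnm_lepP => le_u i; have := le_u i; rewrite mulmnE mnmE; move: p_gt0; nia.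
have [le_u|nle_u] := boolP (u <= m)%MM; last first.
  rewrite !mcoeffMX_eq0 ?E //.
  by apply: (addrI (lam 0)); rewrite -lamD !addr0.
rewrite -[in RHS](submK le_u) addmC mcoeffMX mcoeff_cartier.
rewrite (_ : mshift m = (u *+ p + mshift (m - u)))%MM ?mcoeffMX //.
apply/mnmP => i; rewrite mnmDE mulmnE !mnmE.
by move/mnm_lepP/(_ i): le_u; move: p_gt0; nia.
Qed.

(** The exponent read off for X^m has degree p deg(m) + n(p-1), so homogeneity leaves only m = 0. *)
Lemma cartier_monomial_dominant (f : {mpoly k[n]}) :
  f@_[multinom p.-1 | i < n] = 1 ->
  (forall m, m \in msupp f -> mdeg m = (n * p.-1)%N) -> cartier f = 1.
Proof.
move=> f1 degf; apply/mpolyP => m; rewrite mcoeff_cartier mcoeff1.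
have [->|m0] := eqVneq m 0%MM.
  rewrite (_ : mshift 0 = [multinom p.-1 | i < n]) ?f1 //.
  by apply/mnmP => i; rewrite !mnmE.
rewrite memN_msupp_eq0; first by apply: (addrI (lam 0)); rewrite -lamD !addr0.
apply/negP => /degf; rewrite mdegE (eq_bigr (fun i => m i * p + p.-1)%N); last first.
  by move=> i _; rewrite mnmE.
rewrite big_split /= sum_nat_const card_ord -big_distrl /= -mdegE.
move/eqP; rewrite -[X in _ == X]add0n eqn_add2r muln_eq0 mdeg_eq0 (negPf m0) /=.
by rewrite eqn0Ngt p_gt0.
Qed.

End CartierMap.

(** * Minimal primes of binomial edge ideals *)

Section Dominance.
Variables (N : nat) (k : fieldType) (wt : 'I_N -> nat).
Implicit Types (f h : {mpoly k[N]}) (m u : 'X_{1..N}).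

Definition mweight m : nat := (\sum_i m i * wt i)%N.

Lemma mweightD m u : mweight (m + u) = (mweight m + mweight u)%N.
Proof. by rewrite /mweight -big_split; apply: eq_bigr => i _; rewrite mnmDE mulnDl. Qed.

Lemma mweightU i : mweight U_(i) = wt i.
Proof.
rewrite /mweight (bigD1 i) //= mnm1E eqxx mul1n big1 ?addn0 // => j ji.
by rewrite mnm1E eq_sym (negPf ji).
Qed.

(** The strict weight inequality keeps [m] out of the support of the difference, so X^m has
    coefficient 1 in [f]; the condition is stable under products. *)
Definition dominant f m := forall u, u \in msupp (f - 'X_[m]) ->
  mdeg u = mdeg m /\ (mweight u < mweight m)%N.

Lemma dominant1 : dominant 1 0%MM.
Proof. by move=> u; rewrite mpolyX0 subrr msupp0. Qed.

Lemma dominantM f h m u : dominant f m -> dominant h u -> dominant (f * h) (m + u)%MM.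
Proof.
move=> df dh e.
have -> : f * h - 'X_[m + u] = (f - 'X_[m]) * (h - 'X_[u])
    + ((f - 'X_[m]) * 'X_[u] + 'X_[m] * (h - 'X_[u])).
  by rewrite mpolyXD; ring.
rewrite !(mdegD, mweightD).
have inX v w : v \in msupp ('X_[w] : {mpoly k[N]}) -> v = w.
  by rewrite msuppX inE => /eqP.
move=> /msuppD_le; rewrite mem_cat => /orP [|/msuppD_le]; last rewrite mem_cat => /orP [].
- move=> /msuppM_le /allpairsP [[e1 e2] /= [/df [d1 w1] /dh [d2 w2] ->]].
  by rewrite mdegD mweightD d1 d2; split=> //; move: w1 w2; lia.
- move=> /msuppM_le /allpairsP [[e1 e2] /= [/df [d1 w1] /inX -> ->]].
  by rewrite mdegD mweightD d1; split=> //; rewrite ltn_add2r.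
- move=> /msuppM_le /allpairsP [[e1 e2] /= [/inX -> /dh [d1 w1] ->]].
  by rewrite mdegD mweightD d1; split=> //; rewrite ltn_add2l.
Qed.

Lemma dominant_prod (T : Type) (r : seq T) (F : T -> {mpoly k[N]}) M :
  (forall i, dominant (F i) (M i)) ->
  dominant (\prod_(i <- r) F i) (\big[mnm_add/0%MM]_(i <- r) M i).
Proof.
move=> dF; elim: r => [|i r IHr]; rewrite ?big_nil ?big_cons; first exact: dominant1.
exact: dominantM.
Qed.

Lemma dominantX f m r : dominant f m -> dominant (f ^+ r) (m *+ r)%MM.
Proof.
move=> df; elim: r => [|r IHr]; first by rewrite expr0 mulm0n; exact: dominant1.
by rewrite exprS mulmS; exact: dominantM.
Qed.

Lemma dominant_coeff f m : dominant f m -> f@_m = 1.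
Proof.
move=> df; rewrite -[f](subrK 'X_[m]) mcoeffD mcoeffX eqxx.
rewrite memN_msupp_eq0 ?add0r //; apply/negP => /df [_].
by rewrite ltnn.
Qed.

Lemma dominant_mdeg f m u : dominant f m -> u \in msupp f -> mdeg u = mdeg m.
Proof.
move=> df; rewrite -[f in msupp f](subrK 'X_[m]) => /msuppD_le.
by rewrite mem_cat => /orP [/df [] //|]; rewrite msuppX inE => /eqP ->.
Qed.

End Dominance.

(** * Deformations over a polynomial extension *)

Section PolyPrime.
Variables (S : comNzRingType) (P : set S).
Hypothesis prP : prime_ideal P.

Definition poly_ext : set {poly S} := [set u | forall i, P u`_i].

Lemma poly_ext_is_ideal : is_ideal poly_ext.
Proof.
have hP : is_ideal P by case: prP.
split=> [i|u v hu hv i|u v hv i].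
- by rewrite coef0; exact: is_ideal0.
- by rewrite coefD; exact: is_idealD.
- by rewrite coefM; apply: is_ideal_sum => // j _; exact: is_idealMl.
Qed.

(** As in the lemma of Gauss: if the first coefficients outside [P] have indices i and j, the
    coefficient of index i + j of the product is outside [P]. *)
Lemma poly_ext_prime : prime_ideal poly_ext.
Proof.
have [hP P1 PM] := prP; split=> [||u v uvP]; first exact: poly_ext_is_ideal.
  by move=> /(_ 0%N); rewrite coef1.
apply: contrapT => /not_orP [nu nv].
have minidx (w : {poly S}) : ~ poly_ext w ->
    exists i, ~ P w`_i /\ forall j, (j < i)%N -> P w`_j.
  move=> /existsNP [i0 nwi].
  have ex : exists i, `[< ~ P w`_i >] by exists i0; apply/asboolP.
  case: (ex_minnP ex) => i /asboolP nPi mini; exists i; split=> // j ji.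
  apply: contrapT => nPj; have := mini j (asboolT nPj).
  by rewrite leqNgt ji.
have [i [nui ui]] := minidx u nu; have [j [nvj vj]] := minidx v nv.
apply: (primeMn prP nui nvj).
have := uvP (i + j)%N; rewrite coefM.
have lt_i : (i < (i + j).+1)%N by rewrite ltnS leq_addr.
rewrite (bigD1 (Ordinal lt_i)) //= addKn => sumP.
have restP : P (\sum_(l < (i + j).+1 | l != Ordinal lt_i) u`_l * v`_(i + j - l)).
  apply: is_ideal_sum => // l; rewrite -val_eqE /= => li.
  have [lt_li|le_il] := ltnP l i; first by apply: is_idealMr => //; exact: ui.
  by apply: is_idealMl => //; apply: vj; have := ltn_ord l; lia.
by rewrite -[_ * _](addrK (\sum_(l < (i + j).+1 | l != Ordinal lt_i) u`_l * v`_(i + j - l)));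
  exact: is_idealB.
Qed.

End PolyPrime.


(* The deformed zero locus stays in that of [X], hence in a component, and the
   only component of [ideal_gen X] through the generic point of [P] is [P]. *)
Lemma deform_minimal_prime (S : comNzRingType) (D : {rmorphism S -> {poly S}})
    (X P : set S) z :
  noetherian S -> (forall f, (D f)`_0 = f) -> minimal_prime (ideal_gen X) P ->
  (forall f, X f -> poly_ext P (D f)) -> P z -> poly_ext P (D z).
Proof.
move=> noethS D0 mP XP Pz; have prP : prime_ideal P by case: mP.
have prE := poly_ext_prime prP.
have [m [s Ps Is]] := minimal_prime_nilpotent noethS (ideal_gen_is_ideal X) mP Pz.
have : poly_ext P (D (s * z ^+ m)).
  suff : ideal_gen X `<=` [set f | poly_ext P (D f)] by apply.
  apply: ideal_gen_min => //; have hE := poly_ext_is_ideal prP.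
  split=> [|f h|f h] /=.
  - by rewrite rmorph0; exact: is_ideal0.
  - by rewrite rmorphD; exact: is_idealD.
  - by rewrite rmorphM; exact: is_idealMl.
rewrite rmorphM rmorphXn; case: prE => _ _ EM /EM [/(_ 0%N)|].
  by rewrite D0.
exact: (primeX (poly_ext_prime prP)).
Qed.

(** The direction [d] has polynomial entries, so a point may be moved in a direction depending on
    the point. *)
Lemma deformation (N : nat) (k : fieldType) (d : 'I_N -> {mpoly k[N]}) :
  exists D : {rmorphism {mpoly k[N]} -> {poly {mpoly k[N]}}},
    (forall i, D 'X_i = ('X_i)%:P + (d i)%:P * 'X) /\ forall f, (D f)`_0 = f.
Proof.
exists (mmap (polyC \o @mpolyC N k) (fun i => ('X_i)%:P + (d i)%:P * 'X)).
split=> [i|f]; first by rewrite /= mmapX mmap1U.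
rewrite -horner_coef0 [RHS]mpolyE /= /mmap horner_sum; apply: eq_bigr => m _.
rewrite hornerM hornerC -mul_mpolyC; congr (_ * _).
rewrite /mmap1 horner_prod mpolyXE_id; apply: eq_bigr => i _.
by rewrite horner_exp !hornerE.
Qed.

Section BinomialPrimes.
Variables (k : fieldType) (n : nat) (G : sgraph 'I_n) (P : set {mpoly k[n + n]}).
Hypothesis mP : minimal_prime (binomial_edge_ideal k G) P.
Local Notation S := {mpoly k[n + n]}.
Local Notation x := (@xvar k n).
Local Notation y := (@yvar k n).
Local Notation I := (binomial_edge_ideal k G).

Definition minor2 (i j : 'I_n) : S := x i * y j - y i * x j.
Local Notation f := minor2.

Let prP : prime_ideal P. Proof. by case: mP. Qed.
Let hP : is_ideal P. Proof. by case: prP. Qed.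
Let hI : is_ideal I. Proof. exact: ideal_gen_is_ideal. Qed.

Lemma minor2C i j : f j i = - f i j. Proof. by rewrite /minor2; ring. Qed.
Lemma minor2_id i : f i i = 0. Proof. by rewrite /minor2; ring. Qed.

Lemma edge_ideal i j : G i j -> I (f i j).
Proof. by move=> Gij; apply: ideal_genS; exists (i, j). Qed.

Lemma edge_prime i j : G i j -> P (f i j).
Proof. by move=> /edge_ideal; case: mP => _ sub _; exact: sub. Qed.

(** When (x, y) moves to (x + a eps, y + b eps), [L i j] is the coefficient of eps in the deformed
    minor and a_i b_j - b_i a_j that of eps^2. If both lie in [P] on edges, [deform_minimal_prime]
    applies; the conclusions are coefficients of eps. *)
Lemma deform_edges (a b : 'I_n -> S) :
  let L i j := a i * y j + x i * b j - b i * x j - y i * a j in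
  (forall i j, G i j -> P (L i j) /\ P (a i * b j - b i * a j)) ->
  [/\ forall t, P (x t) -> P (a t), forall t, P (y t) -> P (b t) &
      forall i j, P (f i j) -> P (L i j)].
Proof.
move=> L LP.
have [D [DX D0]] := deformation (fun c => match split c with inl i => a i | inr i => b i end).
have Dx i : D (x i) = (x i)%:P + (a i)%:P * 'X.
  by rewrite DX (unsplitK (inl i)).
have Dy i : D (y i) = (y i)%:P + (b i)%:P * 'X.
  by rewrite DX (unsplitK (inr i)).
have Df i j : D (f i j)
    = (f i j)%:P + (L i j)%:P * 'X + (a i * b j - b i * a j)%:P * 'X * 'X.
  rewrite /minor2 rmorphB !rmorphM Dx !Dy Dx /L.
  by rewrite !(polyCB, polyCD, polyCM); ring.
have extP z : P z -> poly_ext P (D z).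
  apply: deform_minimal_prime mP _ => //; first exact: mpoly_noetherian.
  move=> _ [[i j] /= Gij ->]; rewrite -/(f i j) Df.
  have [PL PQ] := LP i j Gij.
  have hE := poly_ext_is_ideal prP.
  have EC c : P c -> poly_ext P c%:P.
    by move=> Pc l; rewrite coefC; case: ifP => // _; exact: is_ideal0.
  apply: (is_idealD hE); last by do 2!apply: (is_idealMr _ hE); exact: EC.
  by apply: (is_idealD hE); [apply/EC/edge_prime | apply: (is_idealMr _ hE); exact: EC].
split=> [t /extP /(_ 1%N)|t /extP /(_ 1%N)|i j /extP /(_ 1%N)].
- by rewrite Dx coefD coefC coefMX coefC add0r.
- by rewrite Dy coefD coefC coefMX coefC add0r.
- by rewrite Df !(coefD, coefC, coefMX) /= add0r addr0.
Qed.

(** The shears x + eps y and y + eps x fix every minor. *)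
Lemma prime_xy t : P (x t) <-> P (y t).
Proof.
split=> Pt.
- have [|h _ _] := deform_edges (a := y) (b := fun=> 0); last exact: h.
  move=> i j _; rewrite !(mul0r, mulr0, subr0) addr0 mulrC subrr.
  by split; exact: is_ideal0.
- have [|_ h _] := deform_edges (a := fun=> 0) (b := x); last exact: h.
  move=> i j _; rewrite !(mul0r, mulr0, subr0) add0r mulrC subrr.
  by split; exact: is_ideal0.
Qed.

(** Proportionality of columns passes through [j] once [x j] is invertible. *)
Lemma minor2_trans_x i j l : x j * f i l = x l * f i j + x i * f j l.
Proof. by rewrite /minor2; ring. Qed.

Lemma minor2_trans A i j l : is_ideal A -> ~ P (x j) ->
  loc P A (f i j) -> loc P A (f j l) -> loc P A (f i l).
Proof.
move=> hA Pj Aij Ajl; apply: (loc_cancel prP Pj).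
have hL := loc_is_ideal prP hA.
by rewrite minor2_trans_x; apply: is_idealD => //; exact: is_idealMl.
Qed.

Lemma prime_minor2_trans i j l : ~ P (x j) -> P (f i j) -> P (f j l) -> P (f i l).
Proof.
move=> Pj Pij Pjl; have [_ _ PM] := prP.
have : P (x j * f i l) by rewrite minor2_trans_x; apply: is_idealD => //; exact: is_idealMl.
by case/PM.
Qed.

Lemma prime_minor2_var i j : P (x i) -> P (f i j).
Proof.
move=> Pi; rewrite /minor2; apply: is_idealB => //; apply: is_idealMr => //.
exact/prime_xy.
Qed.

(* If all neighbours of [t] outside [T] are proportional modulo [P], then
   [(x t, y t)] can be moved off [0] along that direction. *)
Lemma prime_var_cut t : P (x t) -> exists a b,
  [/\ G t a, G t b, ~ P (x a), ~ P (x b) & ~ P (f a b)].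
Proof.
move=> Pt; apply: contrapT => none.
have prop a b : G t a -> G t b -> ~ P (x a) -> ~ P (x b) -> P (f a b).
  move=> Ga Gb Pa Pb; apply: contrapT => nPf; apply: none.
  by exists a, b; split.
have [[a Gta Pa]|nonbr] := pselect (exists2 a, G t a & ~ P (x a)).
  apply: (Pa); have [|h _ _] := deform_edges (a := fun i => if i == t then x a else 0)
    (b := fun i => if i == t then y a else 0); last first.
    by have := h t Pt; rewrite eqxx.
  have nbr j : G t j -> P (f a j).
    move=> Gtj; have [Pj|Pj] := pselect (P (x j)).
      by rewrite minor2C; apply: is_idealN => //; exact: prime_minor2_var.
    exact: prop.
  move=> i j Gij.
  have [Ei|it] := eqVneq i t; have [Ej|jt] := eqVneq j t.
  + by move: Gij; rewrite Ei Ej (adj_irr G).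
  + rewrite !(mul0r, mulr0, subr0, addr0); split; last exact: is_ideal0.
    by apply: nbr; rewrite -Ei.
  + rewrite !(mul0r, mulr0, subr0, addr0, add0r, oppr0); split; last exact: is_ideal0.
    rewrite -[_ - _]/(f i a) minor2C.
    by apply: (is_idealN hP); apply: nbr; rewrite -Ej adj_sym.
  + by rewrite !(mul0r, mulr0, subr0, addr0); split; exact: is_ideal0.
case: prP => _ + _; apply.
have [|h _ _] := deform_edges (a := fun i => if i == t then 1 else 0)
    (b := fun=> 0); last by have := h t Pt; rewrite eqxx.
have nbr j : G t j -> P (y j).
  by move=> Gtj; apply/prime_xy; apply: contrapT => Pj; apply: nonbr; exists j.
move=> i j Gij; rewrite !(mul0r, mulr0, subr0, addr0); split; last exact: is_ideal0.
have [Ei|it] := eqVneq i t; have [Ej|jt] := eqVneq j t.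
+ by move: Gij; rewrite Ei Ej (adj_irr G).
+ by rewrite mulr0 subr0 mul1r; apply: nbr; rewrite -Ei.
+ rewrite mul0r add0r mulr1; apply: is_idealN => //; apply: nbr.
  by rewrite -Ej adj_sym.
+ by rewrite mul0r mulr0 subr0; exact: is_ideal0.
Qed.

Definition adj_off : rel 'I_n :=
  fun i j => [&& G i j, `[< ~ P (x i) >] & `[< ~ P (x j) >]].

(* Otherwise shearing the component of [a] alone would move [f a b] off [0]. *)
Lemma prime_minor2_connect a b :
  ~ P (x a) -> ~ P (x b) -> P (f a b) -> connect adj_off a b.
Proof.
move=> Pa Pb Pab; apply: contrapT => /negP ncon.
have [|_ _ h] := deform_edges (a := fun i => if connect adj_off a i then y i else 0)
    (b := fun=> 0).
  move=> i j Gij; rewrite !(mul0r, mulr0, subr0, addr0); split; last exact: is_ideal0.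
  have step u v : G u v -> connect adj_off a u -> ~ P (x u) -> ~ P (x v) ->
      connect adj_off a v.
    move=> Guv au Pu Pv; apply: connect_trans au (connect1 _).
    by rewrite /adj_off Guv !asboolT.
  have [ai|nai] := boolP (connect adj_off a i);
    have [aj|naj] := boolP (connect adj_off a j).
  + by rewrite mulrC subrr; exact: is_ideal0.
  + rewrite mulr0 subr0.
    have [/prime_xy Pi|Pi] := pselect (P (x i)); first exact: is_idealMr.
    have [/prime_xy Pj|Pj] := pselect (P (x j)); first exact: is_idealMl.
    by rewrite (step i j) in naj.
  + rewrite mul0r sub0r; apply: is_idealN => //.
    have [/prime_xy Pi|Pi] := pselect (P (x i)); first exact: is_idealMr.
    have [/prime_xy Pj|Pj] := pselect (P (x j)); first exact: is_idealMl.
    by rewrite (step j i) // 1?adj_sym in nai.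
  + by rewrite mul0r mulr0 subrr; exact: is_ideal0.
have := h a b Pab; rewrite connect0 (negPf ncon) !(mul0r, mulr0, subr0, addr0).
by case: prP => _ _ PM /PM [] /prime_xy.
Qed.

(** Cramer's rule: two neighbours [a], [b] of [t] with invertible minor determine the column of [t]
    from the edge minors f_ta and f_tb. *)
Lemma loc_var t : P (x t) -> loc P I (x t) /\ loc P I (y t).
Proof.
move=> /prime_var_cut [a [b [Ga Gb _ _ nPab]]].
have hL := loc_is_ideal prP hI.
have La c : G t c -> loc P I (f t c) by move=> /edge_ideal; exact: sub_loc.
split; apply: (loc_cancel prP nPab).
- rewrite (_ : _ * _ = x a * f t b - x b * f t a) /minor2; last by ring.
  by apply: is_idealB => //; apply: is_idealMl => //; exact: La.
- rewrite (_ : _ * _ = y a * f t b - y b * f t a) /minor2; last by ring.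
  by apply: is_idealB => //; apply: is_idealMl => //; exact: La.
Qed.

Lemma loc_minor2 a b : P (f a b) -> loc P I (f a b).
Proof.
have hL := loc_is_ideal prP hI; move=> Pab.
have varL i j : P (x i) -> loc P I (f i j).
  by move=> /loc_var [lx ly]; apply: is_idealB => //; exact: is_idealMr.
have [Pa|Pa] := pselect (P (x a)); first exact: varL.
have [Pb|Pb] := pselect (P (x b)).
  by rewrite minor2C; apply: is_idealN => //; exact: varL.
have /connectP [s path_s ->] := prime_minor2_connect Pa Pb Pab.
elim/last_ind: s path_s => [|s c IHs]; first by rewrite minor2_id => _; exact: is_ideal0.
rewrite rcons_path last_rcons => /andP [/IHs ls /and3P [Gc /asboolP Pl _]].
by apply: minor2_trans Pl ls _ => //; apply: sub_loc => //; exact: edge_ideal.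
Qed.

End BinomialPrimes.

(** * Vertex orderings *)

Definition simplicial (V : finType) (G : sgraph V) (u : V) : Prop :=
  forall a b, G u a -> G u b -> a != b -> G a b.

(** Keys are arbitrary distinct numbers rather than ranks, so that they can be given by a
    formula. *)
Definition spread_order (V : finType) (G : sgraph V) (key : V -> nat) : Prop :=
  [/\ injective key,
      forall a b c, G a b -> (key a < key c < key b)%N ->
        simplicial G c /\ (G c a || G c b),
      forall a b t, (key a < key b < key t)%N -> G t a -> G t b -> G a b &
      forall t, (forall a, key t <= key a)%N -> simplicial G t].

Section Ordering.
Variables (k : fieldType) (n : nat) (G : sgraph 'I_n) (v : 'I_n -> 'I_n).
Hypothesis v_bij : bijective v.
Hypotheses
  (crossed : forall i j c : 'I_n, G (v i) (v j) -> (i < c < j)%N ->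
     simplicial G (v c) /\ (G (v c) (v i) || G (v c) (v j)))
  (left_clique : forall i j c : 'I_n, (i < j < c)%N ->
     G (v c) (v i) -> G (v c) (v j) -> G (v i) (v j))
  (first_simplicial : forall i : 'I_n, i = 0%N :> nat -> simplicial G (v i)).
Local Notation S := {mpoly k[n + n]}.
Local Notation x := (@xvar k n).
Local Notation y := (@yvar k n).
Local Notation I := (binomial_edge_ideal k G).
Local Notation f := (@minor2 k n).

(* With the conventions [x_{-1} = 1], [y_{-1} = 0], [x_n = 0], [y_n = 1], shifted
   by one, the consecutive minors include the end factors [y_0] and [x_{n-1}]. *)
Definition path_x (j : nat) : S :=
  if j is j'.+1 then oapp (fun i => x (v i)) 0 (insub j') else 1.
Definition path_y (j : nat) : S :=
  if j is j'.+1 then oapp (fun i => y (v i)) 1 (insub j') else 0.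
Definition path_minor (j : nat) : S :=
  path_x j * path_y j.+1 - path_y j * path_x j.+1.

Lemma path_minorE (i j : 'I_n) : j = i.+1 :> nat -> path_minor i.+1 = f (v i) (v j).
Proof. by move=> E; rewrite /path_minor /= -E !valK. Qed.

Lemma path_minor0 (i : 'I_n) : i = 0%N :> nat -> path_minor 0 = y (v i).
Proof. by move=> E; rewrite /path_minor /= -E valK /= mul1r mul0r subr0. Qed.

Lemma path_minor_last (i : 'I_n) : n = i.+1 -> path_minor i.+1 = x (v i).
Proof.
move=> E; rewrite /path_minor /= valK insubF; last by rewrite -E ltnn.
by rewrite /= mulr1 mulr0 subr0.
Qed.

Section AtMinimalPrime.
Variable P : set S.
Hypothesis mP : minimal_prime I P.
Local Notation T u := (P (x u)).

Let prP : prime_ideal P. Proof. by case: mP. Qed.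
Let hP : is_ideal P. Proof. by case: prP. Qed.

Lemma simplicial_notin u : simplicial G u -> ~ T u.
Proof.
move=> simp /(prime_var_cut mP) [a [b [Ga Gb _ _]]]; apply.
have [->|ab] := eqVneq a b; first by rewrite minor2_id; exact: is_ideal0.
by apply: (edge_prime mP); exact: simp.
Qed.

Lemma edge_index_neq (i j : 'I_n) : G (v i) (v j) -> i != j :> nat.
Proof. by apply: contraTneq => /ord_inj ->; rewrite (adj_irr G). Qed.

(** Of two neighbours with minor outside [P], one lies to the right, since left neighbourhoods are
    cliques. *)
Lemma right_neighbour i : T (v i) ->
  exists2 b : 'I_n, (i < b)%N & G (v i) (v b) /\ ~ T (v b).
Proof.
move=> /(prime_var_cut mP) [a' [b' []]]; have [w wK vK] := v_bij.
rewrite -[a']vK -[b']vK; move: (w a') (w b') => a b Ga Gb Ta Tb nPab.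
have [lt_ia|le_ai] := ltnP i a; first by exists a.
have [lt_ib|le_bi] := ltnP i b; first by exists b.
have [Na Nb] := (edge_index_neq Ga, edge_index_neq Gb).
exfalso; have [lt_ab|lt_ba|/ord_inj E] := ltngtP a b.
- apply: nPab; apply: (edge_prime mP); apply: (left_clique (c := i)) => //; lia.
- apply: nPab; apply: (edge_prime mP); rewrite adj_sym.
  apply: (left_clique (c := i)) => //; lia.
- by apply: nPab; rewrite E minor2_id; exact: is_ideal0.
Qed.

Lemma next_notin i : T (v i) -> exists2 j : 'I_n, j = i.+1 :> nat & ~ T (v j).
Proof.
move=> /right_neighbour [b lt_ib [Gb Tb]].
have lt_n : (i.+1 < n)%N := leq_ltn_trans lt_ib (ltn_ord b).
exists (Ordinal lt_n) => //; have [E|Nb] := eqVneq b (Ordinal lt_n); first by rewrite -E.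
have [] := crossed (c := Ordinal lt_n) Gb; last by move=> simp _; exact: simplicial_notin.
by rewrite /= ltnSn /= ltn_neqAle lt_ib andbT eq_sym.
Qed.

Lemma prev_notin i : T (v i) -> exists2 j : 'I_n, i = j.+1 :> nat & ~ T (v j).
Proof.
move=> Ti; have i_gt0 : (0 < i)%N.
  by rewrite lt0n; apply/negP => /eqP /first_simplicial /simplicial_notin.
have lt_n : (i.-1 < n)%N by rewrite (leq_ltn_trans (leq_pred _)).
exists (Ordinal lt_n) => [|/right_neighbour]; first by rewrite /= prednK.
move=> [b /=]; rewrite prednK // => le_ib [Gb Tb].
(* If [i.-1] were also in [T], its edge to [b] would pass over [i] and make [v i] simplicial. *)
have Nb : b != i by apply/eqP => E; apply: Tb; rewrite E.
have [] := crossed (c := i) Gb; last by move=> simp _; case: (simplicial_notin simp).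
by rewrite /= prednK // leqnn /= ltn_neqAle le_ib andbT eq_sym.
Qed.

(** A minor in [P] would give a walk from [v a] to [v b] avoiding [T]; some edge of it passes over
    [i], which makes [v i] simplicial and hence not in [T]. *)
Lemma separated (a b i : 'I_n) : T (v i) -> (a < i < b)%N ->
  ~ T (v a) -> ~ T (v b) -> ~ P (f (v a) (v b)).
Proof.
move=> Ti /andP [lt_ai lt_ib] Ta Tb /(prime_minor2_connect mP Ta Tb).
have [w wK vK] := v_bij; move=> /connectP [s].
have : (i < w (v b))%N by rewrite wK.
move=> + + E; rewrite E {E}; elim/last_ind: s => [|s c IHs].
  by rewrite /= wK => /ltnW; rewrite leqNgt lt_ai.
rewrite last_rcons rcons_path => lt_ic /andP [path_s /and3P [Gc /asboolP Tl /asboolP Tc]].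
have [lt_l|lt_l|/ord_inj E] := ltngtP (w (last (v a) s)) i.
- have [] := @crossed (w (last (v a) s)) (w c) i; rewrite ?vK ?lt_l //.
  by move=> simp _; case: (simplicial_notin simp).
- exact: IHs.
- by apply: Tl; rewrite -[last _ _]vK E.
Qed.

Definition path_ideal : set S :=
  ideal_gen [set h | exists2 i : 'I_n.+1, P (path_minor i) & h = path_minor i].

Lemma path_ideal_minor (i j : 'I_n) : j = i.+1 :> nat ->
  P (f (v i) (v j)) -> loc P path_ideal (f (v i) (v j)).
Proof.
move=> E; have lt_i : (i.+1 < n.+1)%N by rewrite ltnS ltn_ord.
rewrite -path_minorE // => Pij; apply: sub_loc => //; apply: ideal_genS.
by exists (Ordinal lt_i).
Qed.

(** Cramer's rule again, now with the predecessor and the successor of [i], which lie outside [T]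
    and are separated by [i]. *)
Lemma path_ideal_var i : T (v i) ->
  loc P path_ideal (x (v i)) /\ loc P path_ideal (y (v i)).
Proof.
move=> Ti; have [a Ea Ta] := prev_notin Ti; have [b Eb Tb] := next_notin Ti.
have nPab : ~ P (f (v a) (v b)) by apply: (separated Ti) => //; rewrite Eb Ea; lia.
have hL : is_ideal (loc P path_ideal).
  by apply: loc_is_ideal => //; exact: ideal_gen_is_ideal.
have La : loc P path_ideal (f (v a) (v i)).
  apply: path_ideal_minor => //; rewrite minor2C; apply: (is_idealN hP).
  exact: (prime_minor2_var mP).
have Lb : loc P path_ideal (f (v i) (v b)).
  by apply: path_ideal_minor => //; exact: (prime_minor2_var mP).
split; apply: (loc_cancel prP nPab).
- rewrite (_ : _ * _ = x (v a) * f (v i) (v b) + x (v b) * f (v a) (v i)).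
    by apply: (is_idealD hL); exact: (is_idealMl _ hL).
  by rewrite /minor2; ring.
- rewrite (_ : _ * _ = y (v a) * f (v i) (v b) + y (v b) * f (v a) (v i)).
    by apply: (is_idealD hL); exact: (is_idealMl _ hL).
  by rewrite /minor2; ring.
Qed.

Lemma edge_between (i j c : 'I_n) : G (v i) (v j) -> ~ T (v i) -> ~ T (v j) ->
  (i <= c <= j)%N -> ~ T (v c) /\ P (f (v i) (v c)).
Proof.
move=> Gij Ti Tj /andP [le_ic le_cj].
have [/ord_inj <-|Ni] := eqVneq (i : nat) c.
  by split=> //; rewrite minor2_id; exact: is_ideal0.
have [/ord_inj ->|Nj] := eqVneq (c : nat) j; first by split=> //; exact: (edge_prime mP).
have [|simp Gc] := crossed (c := c) Gij; first by rewrite !ltn_neqAle Ni Nj le_ic.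
split; first exact: simplicial_notin.
case/orP: Gc => Gc; first by apply: (edge_prime mP); rewrite adj_sym.
by apply: (prime_minor2_trans mP Tj); apply: (edge_prime mP); rewrite // adj_sym.
Qed.

(** Off [T], all columns from [i] to [j] are proportional modulo [P], so the consecutive minors
    between them lie in [P] and are chained by [minor2_trans]. *)
Lemma path_ideal_edge (i j : 'I_n) : (i < j)%N -> G (v i) (v j) ->
  loc P path_ideal (f (v i) (v j)).
Proof.
move=> lt_ij Gij; have hZ : is_ideal path_ideal by exact: ideal_gen_is_ideal.
have hL := loc_is_ideal prP hZ.
have varL a b : T (v a) -> loc P path_ideal (f (v a) (v b)).
  by move=> /path_ideal_var [lx ly]; apply: (is_idealB hL); exact: (is_idealMr _ hL).
have [Ti|Ti] := pselect (T (v i)); first exact: varL.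
have [Tj|Tj] := pselect (T (v j)).
  by rewrite minor2C; apply: (is_idealN hL); exact: varL.
suff chain d (c : 'I_n) : c = (i + d)%N :> nat -> (c <= j)%N ->
    loc P path_ideal (f (v i) (v c)).
  by apply: (chain (j - i)%N) => //; rewrite subnKC // ltnW.
elim: d c => [|d IHd] c.
  by rewrite addn0 => /ord_inj -> _; rewrite minor2_id; exact: is_ideal0.
move=> Ec le_cj; have lt_e : (i + d < n)%N by have := ltn_ord c; lia.
pose e := Ordinal lt_e.
have [|Te Pe] := @edge_between i j e Gij Ti Tj; first by rewrite /=; lia.
have [|Tc Pc] := @edge_between i j c Gij Ti Tj; first by lia.
apply: (minor2_trans mP hZ Te); first by apply: IHd => //=; lia.
apply: path_ideal_minor; first by rewrite Ec addnS.
by apply: (prime_minor2_trans mP Ti) => //; rewrite minor2C; exact: (is_idealN hP).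
Qed.

Lemma edge_ideal_sub_path_ideal : I `<=` loc P path_ideal.
Proof.
have hL : is_ideal (loc P path_ideal).
  by apply: loc_is_ideal => //; exact: ideal_gen_is_ideal.
apply: (ideal_gen_min hL) => _ [[a b] /= Gab ->]; rewrite -/(f a b).
have [w wK vK] := v_bij; move: Gab; rewrite -[a]vK -[b]vK.
move: (w a) (w b) => i j Gij; have := edge_index_neq Gij.
case: (ltngtP i j) => // ij _; first exact: path_ideal_edge.
rewrite minor2C; apply: (is_idealN hL); apply: path_ideal_edge => //.
by rewrite adj_sym.
Qed.

(** Neither end factor can lie in [P]: the first vertex is simplicial, and the last has no right
    neighbour. *)
Lemma path_minor_loc (i : 'I_n.+1) : P (path_minor i) -> loc P I (path_minor i).
Proof.
case: i => [[|i] /= lt_i].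
  have [lt_n|le_n] := ltnP 0 n.
    rewrite (path_minor0 (i := Ordinal lt_n)) // => /(prime_xy mP).
    by move/(simplicial_notin (first_simplicial _)).
  (* For n = 0 the only factor is 1. *)
  rewrite /path_minor /= insubF ?ltnNge ?le_n //= mulr1 mul0r subr0.
  by case: prP.
have lt_i' : (i < n)%N by [].
have [lt_n|le_n] := ltnP i.+1 n.
  rewrite (path_minorE (i := Ordinal lt_i') (j := Ordinal lt_n)) //.
  exact: (loc_minor2 mP).
have En : n = (Ordinal lt_i').+1 by rewrite /=; lia.
rewrite (path_minor_last En) // => /right_neighbour [b /=].
by have := ltn_ord b; lia.
Qed.

End AtMinimalPrime.

(** * The leading monomial of the product g *)

Definition vertex_weight (c : 'I_(n + n)) : nat :=
  match split c with inl a => (n - index a [seq v i | i <- enum 'I_n])%N | inr _ => 0%N end.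

Lemma vertex_weight_x (i : 'I_n) : vertex_weight (lshift n (v i)) = (n - i)%N.
Proof.
rewrite /vertex_weight (unsplitK (inl (v i))) index_map; last exact: bij_inj.
by rewrite index_enum_ord.
Qed.

Lemma vertex_weight_y (i : 'I_n) : vertex_weight (rshift n i) = 0%N.
Proof. by rewrite /vertex_weight (unsplitK (inr i)). Qed.

(** Exponent of [path_x j] for j <= n; the default at n + 1, where [path_x] is 0, never enters a
    leading term. *)
Definition path_mx (j : nat) : 'X_{1..n + n} :=
  if j is j'.+1 then oapp (fun i => U_(lshift n (v i))%MM) 0%MM (insub j') else 0%MM.
Definition path_my (j : nat) : 'X_{1..n + n} :=
  if j is j'.+1 then oapp (fun i => U_(rshift n (v i))%MM) 0%MM (insub j') else 0%MM.

Lemma path_minor_dominant (i : 'I_n.+1) :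
  dominant vertex_weight (path_minor i) (path_mx i + path_my i.+1)%MM.
Proof.
have lead : path_x i * path_y i.+1 = 'X_[path_mx i + path_my i.+1].
  rewrite mpolyXD; congr (_ * _); last first.
    by rewrite /path_y /path_my; case: insubP => [j _ _|_] //=; rewrite mpolyX0.
  case: i => [[|i] lt_i] /=; first by rewrite mpolyX0.
  by rewrite insubT.
move=> u; rewrite /path_minor lead addrAC subrr add0r.
case: i {lead} => [[|i] lt_i] /=; first by rewrite mul0r oppr0 msupp0.
rewrite insubT /=; case: insubP => [j lt_j Ej|_] /=; last first.
  by rewrite mulr0 oppr0 msupp0.
rewrite (perm_mem (msuppN _)) -mpolyXD msuppX inE => /eqP ->.
rewrite !(mdegD, mdeg1, mweightD, mweightU); split=> //.
by rewrite !vertex_weight_x !vertex_weight_y Ej /=; lia.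
Qed.

(** The leading terms y_1, x_1 y_2, ..., x_(n-1) y_n, x_n use each variable exactly once, thanks to
    the two end factors. *)
Lemma path_monomial :
  (\big[mnm_add/0]_(i < n.+1) (path_mx i + path_my i.+1) = [multinom 1 | c < n + n])%MM.
Proof.
rewrite big_split /= big_ord_recl [X in (_ + X)%MM]big_ord_recr /= add0m.
rewrite [oapp _ _ (insub n)](_ : _ = 0%MM); last by rewrite insubF ?ltnn.
rewrite addm0; apply/mnmP => c; rewrite mnmDE !mnm_sumE mnmE.
have [w wK vK] := v_bij.
rewrite -(splitK c); case: (split c) => a /=.
  rewrite (bigD1 (w a)) //= valK /= vK mnm1E eqxx big1 => [|i iw]; last first.
    rewrite valK /= mnm1E (inj_eq (@lshift_inj _ _)).
    by apply/eqP; rewrite eqb0; apply: contraNneq iw => <-; rewrite wK.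
  by rewrite big1 // => i _; rewrite valK /= mnm1E eq_rlshift.
rewrite big1 ?add0n => [|i _]; last by rewrite valK /= mnm1E eq_lrshift.
rewrite (bigD1 (w a)) //= valK /= vK mnm1E eqxx big1 => [|i iw] //.
rewrite valK /= mnm1E (inj_eq (@rshift_inj _ _)).
by apply/eqP; rewrite eqb0; apply: contraNneq iw => <-; rewrite wK.
Qed.

Lemma ordering_symbolic_F_split (p : nat) (pchark : p \in [pchar k]) :
  symbolic_F_split (pchar_mpoly n pchark) I.
Proof.
have [lam [lamD lamZ lam1]] := pth_root_functional pchark.
apply: (@symbolic_F_split_criterion _ _ _ _ _ n.+1 (fun i => path_minor i)
  (cartier p lam)).
- exact: mpoly_noetherian.
- by move=> h m /eqP; rewrite expf_eq0 => /andP [_ /eqP].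
- exact: cartierD.
- exact: cartierZ.
- have dom := dominantX (r := p.-1) (dominant_prod (r := index_enum _) path_minor_dominant).
  rewrite path_monomial in dom.
  have E : ([multinom 1 | c < n + n] *+ p.-1 = [multinom p.-1 | c < n + n])%MM.
    by apply/mnmP => c; rewrite mulmnE !mnmE mul1n.
  rewrite E in dom; apply: cartier_monomial_dominant => //.
    exact: dominant_coeff dom.
  move=> m /(dominant_mdeg dom) ->; rewrite mdegE.
  by rewrite (eq_bigr (fun=> p.-1)) ?sum_nat_const ?card_ord // => i _; rewrite mnmE.
- exact: ideal_gen_is_ideal.
- by move=> P i mP; exact: path_minor_loc.
- by move=> P mP; exact: edge_ideal_sub_path_ideal.
Qed.

End Ordering.

Local Close Scope classical_set_scope.
Local Close Scope ring_scope.

(** * Net-free generalized caterpillars *)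

(** Ranking by the number of smaller keys gives a permutation, whose inverse lists the vertices in
    order. *)
Lemma spread_order_symbolic_F_split (k : fieldType) (p : nat)
    (pchark : p \in [pchar k]%R) (n : nat) (G : sgraph 'I_n) (key : 'I_n -> nat) :
  spread_order G key -> symbolic_F_split (pchar_mpoly n pchark) (binomial_edge_ideal k G).
Proof.
move=> [key_inj crossed left_clique first_simp].
pose below a := [set b | key b < key a]%SET.
have lt_below a : #|below a| < n.
  rewrite -[X in _ < X]card_ord -cardsT; apply: proper_card; apply/properP.
  by split; [exact: finset.subsetT | exists a; rewrite !inE // ltnn].
pose w a := Ordinal (lt_below a).
have w_mono a b : key a < key b -> w a < w b.
  move=> lt_ab; apply: proper_card; apply/properP; split; last first.
    by exists a; rewrite inE // ltnn.
  by apply/fintype.subsetP => c; rewrite !inE => /ltn_trans; apply.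
have w_inj : injective w.
  move=> a b E; apply: key_inj; have [/w_mono|/w_mono|//] := ltngtP (key a) (key b);
    by rewrite E ltnn.
have [v wK vK] := injF_bij w_inj.
have key_v (i j : 'I_n) : i < j -> key (v i) < key (v j).
  move=> lt_ij; have [//|/w_mono|/key_inj/(congr1 w)] := ltngtP (key (v i)) (key (v j)).
    by rewrite !vK ltnNge ltnW.
  by rewrite !vK => E; rewrite E ltnn in lt_ij.
apply: (@ordering_symbolic_F_split _ _ _ v); first by exists w.
- by move=> i j c Gij /andP [ic cj]; apply: crossed => //; rewrite !key_v.
- by move=> i j c /andP [ij jc]; apply: left_clique; rewrite !key_v.
- move=> i i0; apply: first_simp => a; rewrite leqNgt; apply/negP => /w_mono.
  by rewrite vK i0.
Qed.

(** Both positions lie in one block [2j, 2j+2], which holds the clique on the j-th path edge. *)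
Definition window (m m' : nat) : Prop :=
  exists j, [/\ j * 2 <= m, m <= j * 2 + 2, j * 2 <= m' & m' <= j * 2 + 2].

Lemma window_sym m m' : window m m' <-> window m' m.
Proof. by split=> -[j [? ? ? ?]]; exists j. Qed.

(* [pos] puts the i-th vertex of the path at [2i] and the vertices joined via
   the edge from the i-th to the next at [2i+1]. *)
Definition clique_chain (W : finType) (H : sgraph W) (l : nat) (pos : W -> nat) : Prop :=
  [/\ forall a b, H a b <-> a != b /\ window (pos a) (pos b),
      forall a b, ~~ odd (pos a) -> pos a = pos b -> a = b,
      forall i, i <= l -> exists a, pos a = i * 2 &
      forall a, pos a <= l * 2].

(** Each join fills the odd position of its edge. The induction also records that occupied odd
    positions belong to edges already in [E], so distinctness of the edges makes the new position
    vacant. *)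
Lemma clique_joins_chain (l : nat) (W : finType) (H : sgraph W)
    (f : 'I_l.+1 -> W) (E : {set {set 'I_l.+1}}) :
  clique_joins (path_graph l.+1) H f E -> exists pos, clique_chain H l pos.
Proof.
move=> joins; suff [pos [chain _ _]] : exists pos, [/\ clique_chain H l pos,
    forall i : 'I_l.+1, pos (f i) = i * 2 &
    forall a m, pos a = m * 2 + 1 -> exists w1 w2 : 'I_l.+1,
      [/\ [set w1; w2]%SET \in E, w1 = m :> nat & w2 = m.+1 :> nat]].
  by exists pos.
elim: joins => {W H f E}
  [|W H f E w1 w2 t _ [pos [[posH pos_inj pos_ex pos_le] posf posE]] Pw wE t3].
  exists (fun i : 'I_l.+1 => i * 2); split=> //; last by move=> a m; lia.
  split.
  - move=> a b; rewrite /= /path_rel -val_eqE /=; split.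
      by case/orP => /eqP E; (split; first lia);
        [exists (a : nat) | exists (b : nat)]; split; lia.
    by move=> [ab [j [? ? ? ?]]]; lia.
  - by move=> a b _ E; apply: ord_inj; lia.
  - by move=> i le_i; exists (Ordinal (le_i : i < l.+1)).
  - by move=> a; have := ltn_ord a; lia.
pose m := minn w1 w2.
have w12 : (w1 = m :> nat /\ w2 = m.+1 :> nat) \/ (w2 = m :> nat /\ w1 = m.+1 :> nat).
  by move: Pw; rewrite /= /path_rel /m => /orP [] /eqP; lia.
have empty a : pos a <> m * 2 + 1.
  move=> /posE [u1 [u2 [uE u1m u2m]]]; move: wE; case: w12 => [[E1 E2]|[E1 E2]].
    have -> : w1 = u1 by apply: ord_inj; rewrite E1.
    have -> : w2 = u2 by apply: ord_inj; rewrite E2.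
    by rewrite uE.
  have -> : w1 = u2 by apply: ord_inj; rewrite E2.
  have -> : w2 = u1 by apply: ord_inj; rewrite E1.
  by rewrite finset.setUC uE.
have fP a (i : 'I_l.+1) : (a == f i) = (pos a == i * 2).
  apply/eqP/eqP => [->|Ea]; first exact: posf.
  by apply: pos_inj; rewrite ?posf // Ea; lia.
have joinP a : (a == f w1) || (a == f w2) <-> window (pos a) (m * 2 + 1).
  rewrite !fP; split.
    by case: w12 => [[-> ->]|[-> ->]] /orP [] /eqP Ea; exists m; split; lia.
  case=> j [? ? ? ?]; have := empty a; case: w12 => [[-> ->]|[-> ->]]; lia.
exists (fun c => match c with inl a => pos a | inr _ => m * 2 + 1 end).
split=> [|//|]; first split.
- move=> [a|i] [b|j]; rewrite /=.
  + exact: posH.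
  + by split=> [/joinP|[_ /joinP]].
  + by split=> [/joinP /window_sym|[_ /window_sym /joinP]].
  + by split=> [ij|[]//]; split=> //; exists m; split; lia.
- move=> [a|i] [b|j] ev Eab; rewrite /= in ev Eab; try lia.
  by rewrite (pos_inj a b).
- by move=> i /pos_ex [a posa]; exists (inl a).
- move=> [a|i]; first exact: pos_le.
  by have := ltn_ord w1; have := ltn_ord w2; case: w12; lia.
move=> [a|i] u Eu.
  have [u1 [u2 [uE u1m u2m]]] := posE a u Eu.
  by exists u1, u2; split=> //; exact: finset.setU1r.
have {Eu} -> : u = m by lia.
case: w12 => -[E1 E2]; [exists w1, w2 | exists w2, w1]; split=> //.
  exact: finset.setU11.
by rewrite [X in X \in _]finset.setUC finset.setU11.
Qed.

(** Vertices with equal closed neighbourhoods in [H] can exchange positions, which moves whiskers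
    onto an end of the path. *)
Lemma clique_chain_swap (W : finType) (H : sgraph W) l pos (a b : W) :
  clique_chain H l pos ->
  (forall c, window (pos a) (pos c) <-> window (pos b) (pos c)) ->
  clique_chain H l (pos \o tperm a b).
Proof.
move=> [posH pos_inj pos_ex pos_le] twin.
have swapl u c : window (pos (tperm a b u)) (pos c) <-> window (pos u) (pos c).
  by case: tpermP => [->|->|//]; rewrite twin.
have swap u v : window (pos (tperm a b u)) (pos (tperm a b v)) <-> window (pos u) (pos v).
  split=> [/swapl /window_sym /swapl /window_sym //|win].
  by apply/swapl/window_sym/swapl/window_sym.
split=> /=.
- move=> u v; split=> [/posH [uv win]|[uv win]]; first by split=> //; exact/swap.
  by apply/posH; split=> //; exact/swap.
- by move=> u v ev E; apply: (@perm_inj _ (tperm a b)); exact: pos_inj.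
- by move=> i /pos_ex [c posc]; exists (tperm a b c); rewrite tpermK.
- by move=> u; exact: pos_le.
Qed.

(** No two vertices of the net have the same neighbours, so injectivity follows from the adjacency
    pattern. *)
Lemma has_net (V : finType) (G : sgraph V) (a b c a' b' c' : V) :
  [/\ G a b, G a c & G b c] -> [/\ G a a', G b b' & G c c'] ->
  [/\ ~~ G a b', ~~ G a c' & ~~ G b a'] -> [/\ ~~ G b c', ~~ G c a' & ~~ G c b'] ->
  [/\ ~~ G a' b', ~~ G a' c' & ~~ G b' c'] -> has_induced G net.
Proof.
move=> [ab ac bc] [aa bb cc] [ab' ac' ba'] [bc' ca' cb'] [a'b' a'c' b'c'].
pose f (u : 'I_3 + 'I_3) : V :=
  match u with inl i => nth a [:: a; b; c] i | inr i => nth a [:: a'; b'; c'] i end.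
have fG u v : net u v = G (f u) (f v).
  have rules := (ab, ac, bc, aa, bb, cc, (negbTE ab', negbTE ac', negbTE ba',
    negbTE bc', negbTE ca', negbTE cb', negbTE a'b', negbTE a'c', negbTE b'c')).
  by case: u => [[[|[|[|//]]] ?]|[[|[|[|//]]] ?]];
     case: v => [[[|[|[|//]]] ?]|[[|[|[|//]]] ?]];
     rewrite /f /= /complete_rel -?val_eqE /= ?(adj_irr G) ?rules // (adj_sym G) rules.
have third (i j : 'I_3) : exists2 e, e != i & e != j.
  have [e] : exists e, e \notin [:: i; j].
    apply/existsP; apply: contraT; rewrite negb_exists => /forallP all_in.
    have : #|'I_3| <= #|[:: i; j]|.
      by apply: subset_leq_card; apply/fintype.subsetP => e _; have := all_in e; rewrite negbK.
    by rewrite card_ord => /leq_trans /(_ (card_size _)).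
  by rewrite !inE => /norP [ei ej]; exists e.
exists f => // u v fuv.
have same z : net u z = net v z by rewrite !fG fuv.
case: u v same {fuv} => [i|i] [j|j] same.
- by have := same (inr i); rewrite /= eqxx => /esym /eqP ->.
- have [e ei ej] := third i j; have := same (inl e).
  by rewrite /= /complete_rel eq_sym ei (negPf ej).
- have [e ei ej] := third i j; have := same (inl e).
  by rewrite /= /complete_rel eq_sym [j == e]eq_sym ej [i == e]eq_sym (negPf ei).
- by have := same (inl i); rewrite /= eqxx => /esym /eqP ->.
Qed.

Section Whiskers.
Variables (W : finType) (H : sgraph W) (l q : nat) (w : 'I_q -> W).
Local Notation G := (whiskers H w).

(** A whiskered joined vertex forms a triangle with the ends [a], [b] of its edge; a net appears
    once [a] and [b] have private neighbours, either the next path vertex outwards or a whisker. At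
    an extreme block lacking such a whisker, the joined vertex first trades places with the path
    end. *)
Lemma net_free_even_whiskers pos0 : clique_chain H l pos0 -> net_free G ->
  exists pos, clique_chain H l pos /\ forall i, ~~ odd (pos (w i)).
Proof.
move=> chain0 nonet.
have [l0|l_gt0] := posnP l.
  have [_ _ _ pos_le] := chain0; exists pos0; split=> // i.
  by have := pos_le (w i); rewrite l0; case: (pos0 _).
pose wh a := exists i, w i = a.
pose right_ok pos := (exists b, pos b = l * 2 /\ wh b) \/
  (forall a, wh a -> pos a <> (l * 2).-1).
pose left_ok pos := (exists b, pos b = 0 /\ wh b) \/ (forall a, wh a -> pos a <> 1).
have [pos1 [chain1 right1]] : exists pos, clique_chain H l pos /\ right_ok pos.
  have [ok|/not_orP [_ /existsNP [a /not_implyP [wa /contrapT posa]]]] :=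
    pselect (right_ok pos0); first by exists pos0.
  have [_ _ pos_ex pos_le] := chain0; have [b posb] := pos_ex l (leqnn l).
  exists (pos0 \o tperm a b); split; last by left; exists a; rewrite /= tpermL posb.
  apply: clique_chain_swap chain0 _ => c; rewrite posa posb; have := pos_le c.
  by split=> -[j [? ? ? ?]]; exists l.-1; split; lia.
have [pos [chain [right_pos left_pos]]] :
    exists pos, clique_chain H l pos /\ right_ok pos /\ left_ok pos.
  have [ok|/not_orP [nob /existsNP [a /not_implyP [wa /contrapT posa]]]] :=
    pselect (left_ok pos1); first by exists pos1.
  have [_ pos_inj pos_ex pos_le] := chain1; have [b posb] := pos_ex 0 (leq0n l).
  exists (pos1 \o tperm a b); split; last split.
  - apply: clique_chain_swap chain1 _ => c; rewrite posa posb.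
    by split=> -[j [? ? ? ?]]; exists 0; split; lia.
  (* The left swap keeps [right_ok] even for l = 1, because the vertex [b] moved to position 1
     carries no whisker. *)
  - case: right1 => [[c [posc wc]]|ok].
      left; exists c; split=> //=; rewrite tpermD //; apply/eqP => E.
        by move: posc; rewrite -E posa; lia.
      by move: posc; rewrite -E posb; lia.
    right=> c wc /=; case: tpermP => [E|E|_ _]; last exact: ok.
      by rewrite posb; lia.
    by case: nob; exists b; rewrite posb -E.
  - by left; exists a; rewrite /= tpermL posb.
have [posH pos_inj pos_ex pos_le] := chain; exists pos; split=> // i.
apply/negP => odd_i; apply: nonet; have ui := pos_le (w i).
pose j := (pos (w i))./2; have posu : pos (w i) = j * 2 + 1 by rewrite /j; lia.
have [a posa] : exists a, pos a = j * 2 by apply: pos_ex; lia.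
have [b posb] : exists b, pos b = j.+1 * 2 by apply: pos_ex; lia.
have [a' Ea] : exists a' : W + 'I_q, (exists2 i0, a' = inr i0 & w i0 = a) \/
    (exists2 c, a' = inl c & (pos c).+2 = pos a).
  have [j0|j_gt0] := posnP j.
    case: left_pos => [[c [posc [i0 wc]]]|]; last first.
      by move=> /(_ (w i)); rewrite posu j0; case=> //; exists i.
    exists (inr i0); left; exists i0 => //; rewrite wc.
    by apply: pos_inj; rewrite posc // posa j0.
  have [c posc] : exists c, pos c = j.-1 * 2 by apply: pos_ex; lia.
  by exists (inl c); right; exists c => //; lia.
have [b' Eb] : exists b' : W + 'I_q, (exists2 i0, b' = inr i0 & w i0 = b) \/
    (exists2 c, b' = inl c & pos c = (pos b).+2).
  have [jl|jl] := eqVneq j.+1 l.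
    case: right_pos => [[c [posc [i0 wc]]]|]; last first.
      by move=> /(_ (w i)); case; [exists i | lia].
    exists (inr i0); left; exists i0 => //; rewrite wc.
    by apply: pos_inj; lia.
  have [c posc] : exists c, pos c = j.+2 * 2 by apply: pos_ex; lia.
  by exists (inl c); right; exists c => //; lia.
have neq c d : pos c <> pos d -> (c == d) = false.
  by move=> ne; apply/eqP => E; apply: ne; rewrite E.
have adjP c d : pos c <> pos d -> window (pos c) (pos d) -> H c d.
  by move=> ne win; apply/posH; rewrite neq.
have nadj c d : ~ window (pos c) (pos d) -> ~~ H c d.
  by move=> nwin; apply/negP => /posH [].
have nwin c d : (pos c).+2 < pos d -> ~ window (pos c) (pos d).
  by move=> lt [m [? ? ? ?]]; lia.
have nwin' c d : pos c = j * 2 + 1 -> (pos d).+2 = j * 2 -> ~ window (pos c) (pos d).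
  by move=> ? ? [m [? ? ? ?]]; lia.
apply: (@has_net _ G (inl a) (inl (w i)) (inl b) a' (inr i) b').
- by split; apply: adjP; try lia; exists j; split; lia.
- split=> //=.
  + case: Ea => [[i0 -> wi0] /=|[c -> posc]]; first by rewrite wi0.
    by apply: adjP; [lia | exists j.-1; split; lia].
  + case: Eb => [[i0 -> wi0] /=|[c -> posc]]; first by rewrite wi0.
    by apply: adjP; [lia | exists j.+1; split; lia].
- split.
  + by rewrite /= neq //; lia.
  + case: Eb => [[i0 -> wi0] /=|[c -> posc]]; first by rewrite wi0 neq //; lia.
    by apply: nadj; case=> m [? ? ? ?]; lia.
  + case: Ea => [[i0 -> wi0] /=|[c -> posc]]; first by rewrite wi0 neq //; lia.
    by apply: nadj; case=> m [? ? ? ?]; lia.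
- split.
  + case: Eb => [[i0 -> wi0] /=|[c -> posc]]; first by rewrite wi0 neq //; lia.
    by apply: nadj; case=> m [? ? ? ?]; lia.
  + case: Ea => [[i0 -> wi0] /=|[c -> posc]]; first by rewrite wi0 neq //; lia.
    by apply: nadj; case=> m [? ? ? ?]; lia.
  + by rewrite /= neq //; lia.
- split.
  + case: Ea => [[i0 -> wi0] /=|[c -> posc] /=]; first by [].
    by rewrite neq //; lia.
  + case: Ea => [[i0 -> wi0]|[c -> posc]]; case: Eb => [[i1 -> wi1]|[d -> posd]] //=.
    * by rewrite wi0 neq //; lia.
    * by rewrite wi1 neq //; lia.
    * by apply: nadj; case=> m [? ? ? ?]; lia.
  + case: Eb => [[i0 -> wi0] /=|[c -> posc] /=] //.
    by rewrite neq //; lia.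
Qed.

Lemma clique_chain_spread_order pos : clique_chain H l pos ->
  (forall i, ~~ odd (pos (w i))) -> exists key, spread_order G key.
Proof.
move=> [posH pos_inj pos_ex pos_le] even_w.
(* If the first path vertex has whiskers, one of them is put first, since a leaf is simplicial; all
   others follow their vertex. Ties in [K] are broken by [enum_rank]. *)
pose s0 := [pick i | pos (w i) == 0].
pose K (u : W + 'I_q) : nat := match u with
  | inl a => pos a * 2 + 1
  | inr i => if s0 == Some i then 0 else pos (w i) * 2 + 2 end.
pose N := #|{: W + 'I_q}|.
pose key u := K u * N + enum_rank u.
have rank_lt (u : W + 'I_q) : enum_rank u < N by rewrite /N; exact: ltn_ord.
have keyK u v : key u <= key v -> K u <= K v.
  by have := rank_lt u; have := rank_lt v; rewrite /key; nia.
have key_inj : injective key.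
  move=> u v E; apply: enum_rank_inj; apply: ord_inj.
  have : K u = K v by apply/eqP; rewrite eqn_leq !keyK // E.
  by move: E; rewrite /key; nia.
have s0P i : s0 = Some i -> pos (w i) = 0.
  by rewrite /s0; case: pickP => // i0 /eqP p0 [<-].
have K_inr i : s0 = Some i /\ K (inr i) = 0 \/ K (inr i) = pos (w i) * 2 + 2.
  by rewrite /K; case: eqP => [->|_]; [left | right].
have posE a b : ~~ odd (pos a) -> pos b = pos a -> b = a.
  by move=> ev E; apply/esym/pos_inj.
have leaf i : simplicial G (inr i).
  move=> [a|a] [b|b] //= /eqP -> /eqP ->; by rewrite eqxx.
have odd_simp e : odd (pos e) -> simplicial G (inl e).
  move=> odd_e [a|i] [b|i'] //=; last 3 first.
  - by move=> _ /eqP E; move: (even_w i'); rewrite -E odd_e.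
  - by move=> /eqP E; move: (even_w i); rewrite -E odd_e.
  - by move=> /eqP E; move: (even_w i); rewrite -E odd_e.
  move=> /posH [_ [j [? ? ? ?]]] /posH [_ [j' [? ? ? ?]]] ab.
  by apply/posH; split=> //; exists j; split; lia.
exists key; split=> //.
- move=> a b c Gab /andP [lt_ac lt_cb].
  have [leK1 leK2] := (keyK _ _ (ltnW lt_ac), keyK _ _ (ltnW lt_cb)).
  have Nac : a <> c by move=> E; rewrite E ltnn in lt_ac.
  have Ncb : c <> b by move=> E; rewrite E ltnn in lt_cb.
  case: a b c Gab leK1 leK2 Nac Ncb {lt_ac lt_cb} => [a|i] [b|j] [c|m] //=.
  (* Between two adjacent vertices of the chain lie only joined vertices of their block and, in the
     next case, whiskers of [a]. *)
  + move=> /posH [ab [j [? ? ? ?]]] leK1 leK2 Nac Ncb.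
    have Pac : pos c <> pos a \/ odd (pos a).
      have [|ev] := boolP (odd (pos a)); first by right.
      by left=> E; apply: Nac; rewrite (posE a c).
    have Pbc : pos c <> pos b \/ odd (pos b).
      have [|ev] := boolP (odd (pos b)); first by right.
      by left=> E; apply: Ncb; rewrite (posE b c).
    have odd_c : odd (pos c) by lia.
    split; first exact: odd_simp.
    apply/orP; left; apply/posH; split; last by exists j; split; lia.
    by apply/eqP => E; apply: Nac; rewrite E.
  + move=> /posH [ab [j [? ? ? ?]]] leK1 leK2 _ _; split; first exact: leaf.
    apply/orP; left; have ev := even_w m; apply/eqP; apply: posE => //.
    have [[_ K0]|Km] := K_inr m; first by move: leK1; rewrite -/(K (inr m)) K0; lia.
    by move: leK1 leK2; rewrite -/(K (inr m)) Km; lia.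
  + move=> /eqP E leK1 leK2 Nac _; exfalso; apply: Nac; congr inl; rewrite E.
    have ev := even_w j; apply/esym/posE => //; rewrite -E in ev *.
    have [[_ K0]|Kj] := K_inr j; first by move: leK1 leK2; rewrite -/(K (inr j)) K0; lia.
    by move: leK1 leK2; rewrite -/(K (inr j)) Kj -E; lia.
  + move=> /eqP E leK1 leK2 _ _; split; first exact: leaf.
    have ev := even_w j; rewrite orbF; apply/eqP; rewrite E; apply: posE; first exact: even_w.
    have [[_ K0]|Kj] := K_inr j; first by move: leK1 leK2; rewrite -/(K (inr j)) K0 E; lia.
    have [[_ K0]|Km] := K_inr m; first by move: leK1; rewrite -/(K (inr m)) K0; lia.
    by move: leK1 leK2; rewrite -/(K (inr j)) -/(K (inr m)) Kj Km E; lia.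
  + move=> /eqP E leK1 leK2 _ Ncb; exfalso; apply: Ncb; congr inl.
    have ev := even_w i; rewrite E; apply: posE => //.
    have [[/s0P p0 K0]|Ki] := K_inr i; last by move: leK1 leK2; rewrite -/(K (inr i)) Ki E; lia.
    by move: leK2; rewrite E p0; lia.
  + move=> /eqP E leK1 leK2 Nac Ncb; exfalso.
    have [[s0i K0]|Ki] := K_inr i; last by move: leK1 leK2; rewrite -/(K (inr i)) Ki E; lia.
    have p0 := s0P _ s0i.
    have [[s0m _]|Km] := K_inr m; last by move: leK2; rewrite -/(K (inr m)) Km E p0; lia.
    by apply: Nac; move: s0m; rewrite s0i => -[->].
- move=> a b t /andP [lt_ab lt_bt].
  have [leK1 leK2] := (keyK _ _ (ltnW lt_ab), keyK _ _ (ltnW lt_bt)).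
  have Nab : a <> b by move=> E; rewrite E ltnn in lt_ab.
  have Nbt : b <> t by move=> E; rewrite E ltnn in lt_bt.
  case: t a b leK1 leK2 Nab Nbt {lt_ab lt_bt} => [e|m] [a|i] [b|j] //=.
  + move=> leK1 leK2 Nab Nbt /posH [ea [j [? ? ? ?]]] /posH [eb [j' [? ? ? ?]]].
    have Pbe : pos b <> pos e \/ odd (pos e).
      have [|ev] := boolP (odd (pos e)); first by right.
      by left=> E; apply: Nbt; rewrite (posE e b).
    apply/posH; split; first by apply/eqP => E; apply: Nab; rewrite E.
    have Pae : pos a <> pos e \/ odd (pos e) by lia.
    (* A path vertex may lie in two blocks; its left neighbours are in the lower one. *)
    exists (minn j j'); split; lia.
  + move=> leK1 leK2 _ _ _ /eqP E; exfalso; move: leK1 leK2; rewrite -/(K (inr j)).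
    by have [[_ ->]|->] := K_inr j; rewrite ?E; lia.
  + move=> leK1 leK2 _ Nbt /eqP E _; exfalso; move: leK1 leK2; rewrite -/(K (inr i)).
    have [[/s0P p0 ->]|->] := K_inr i; rewrite ?E; last by lia.
    rewrite p0 => _ leK2; apply: Nbt; congr inl; rewrite E; apply: posE; first exact: even_w.
    lia.
  + move=> leK1 leK2 Nab _ /eqP Ei /eqP Ej; exfalso; move: leK1 leK2.
    rewrite -/(K (inr i)) -/(K (inr j)).
    have [[s0i _]|->] := K_inr i; last by rewrite -Ei; lia.
    have [[s0j _]|->] := K_inr j; last by rewrite -Ej; lia.
    by move=> _ _; apply: Nab; move: s0i; rewrite s0j => -[->].
  + by move=> _ _ Nab _ /eqP Ea /eqP Eb; exfalso; apply: Nab; rewrite Ea Eb.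
- move=> [e|i] min_t; last exact: leaf.
  have [a0 posa0] := pos_ex 0 (leq0n l).
  have pe : pos e = 0 by have /keyK /= := min_t (inl a0); rewrite posa0; lia.
  (* A whisker at [e] would make [s0] nonempty and yield the smaller value [K] = 0. *)
  have nowh i : e != w i.
    apply/eqP => E; move: (erefl s0); rewrite {2}/s0; case: pickP => [i0 _ s0i|/(_ i)].
      by have /keyK /= := min_t (inr i0); rewrite s0i eqxx; lia.
    by rewrite -E pe.
  move=> [a|i] [b|j] //=; rewrite ?(negPf (nowh _)) // => /posH [_ [j [? ? ? ?]]].
  move=> /posH [_ [j' [? ? ? ?]]] ab; apply/posH; split=> //.
  by exists 0; split; lia.
Qed.

End Whiskers.

Lemma spread_order_iso (V V' : finType) (G : sgraph V) (G' : sgraph V') :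
  isomorphic G G' -> (exists key, spread_order G' key) -> exists key, spread_order G key.
Proof.
case=> f [g fK gK] fG [key [key_inj crossed left_clique first_simp]].
have simp u : simplicial G' (f u) -> simplicial G u.
  by move=> su a b; rewrite !fG => fa fb ab; apply: su => //; rewrite (can_eq fK).
exists (key \o f); split=> /=.
- by move=> u v /key_inj /(can_inj fK).
- by move=> a b c; rewrite !fG => Gab /(crossed _ _ _ Gab) [/simp].
- by move=> a b t; rewrite !fG; exact: left_clique.
- by move=> t min_t; apply/simp/first_simp => a; rewrite -[a]gK.
Qed.

Lemma net_free_caterpillar_spread_order (V : finType) (G : sgraph V) :
  generalized_caterpillar G -> net_free G -> exists key, spread_order G key.
Proof.
move=> [l [W [H [f [E [q [w [joins iso]]]]]]]] nonet.
apply: (spread_order_iso iso); have [pos0 chain0] := clique_joins_chain joins.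
have [|pos [chain even_w]] := net_free_even_whiskers chain0 (w := w).
  case: iso => g [h gK hK] gG [e e_inj eG]; apply: nonet.
  exists (h \o e); first exact: inj_comp (can_inj hK) e_inj.
  by move=> u v /=; rewrite gG !hK -eG.
exact: clique_chain_spread_order chain even_w.
Qed.

Theorem corollary3p9 (k : fieldType) (p : nat) (pchark : p \in [pchar k]%R)
    (n : nat) (G : sgraph 'I_n) (Gcat : generalized_caterpillar G)
    (Gnet : net_free G) :
  symbolic_F_split (R := {mpoly k[n + n]}) (pchar_mpoly n pchark)
    (binomial_edge_ideal k G).
Proof.
have [key order_key] := net_free_caterpillar_spread_order Gcat Gnet.
exact: spread_order_symbolic_F_split order_key.
Qed.
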